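(* There exists an absolute constant $c>0$ such that the following holds for all positive integers $k$ and $t$. If $T$ is a strongly $c\cdot kt$-connected tournament, then there is a partition $\{V_1,\ldots,V_t\}$ of $V(T)$ such that the induced subtournament $T[V_i]$ is strongly $k$-connected for every $i\in[t]$.
   Context: A tournament is an orientation of a complete graph. A digraph $D$ is strongly connected if for all $u,v\in V(D)$ there is a directed path from $u$ to $v$. For a positive integer $m$, a digraph $D$ is strongly $m$-connected if $|V(D)|\ge m+1$ and $D\setminus Z$ is strongly connected for every $Z\subseteq V(D)$ with $|Z|<m$. For $U\subseteq V(T)$, $T[U]$ denotes the subtournament induced on $U$. $[t]=\{1,\ldots,t\}$. *)

(* Defs.v *)
From mathcomp Require Import all_boot.
Set Implicit Arguments. Unset Strict Implicit. Unset Printing Implicit Defensive.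

Definition is_tournament (V : finType) (E : rel V) : Prop :=
  (forall u, ~~ E u u) /\ (forall u v, u != v -> E u v (+) E v u).

Definition restrict_rel (V : finType) (E : rel V) (S : {set V}) : rel V :=
  fun u v => [&& u \in S, v \in S & E u v].

Definition strongly_connected_on (V : finType) (E : rel V) (S : {set V}) : Prop :=
  forall u v, u \in S -> v \in S -> connect (restrict_rel E S) u v.

Definition strongly_kconnected_on (V : finType) (E : rel V) (m : nat)
    (S : {set V}) : Prop :=
  m.+1 <= #|S| /\
  forall Z : {set V}, Z \subset S -> #|Z| < m -> strongly_connected_on E (S :\: Z).

(* Main.v *)
(*
Let X be a set of O(kt) vertices of lowest out-degree, Y one of O(kt) vertices of lowest in-degree,
and take (Menger) a family of O(kt) disjoint X-Y paths of minimal total length.  By minimality every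
vertex of a path after the second one dominates all vertices of X lying on no path, and a vertex on
no path either does the same or has out-neighbours on the paths only among the first three vertices
of each.  Hence the unused vertices of X (and, symmetrically, of Y) can serve as hubs.

Each of 2t colours gets k of the paths and O(k) hubs; all other vertices are coloured at random.
Inside a colour class every vertex still reaches a hub after the deletion of fewer than k vertices,
and every hub still reaches the start x of every path: a vertex outside X has out-degree at least
that of x, so that all but few of them have many paths of length 2 to x.  Symmetrically for Y, and
one of the k paths is undamaged.  Few colour classes fail; t of the others are kept, and each left
over vertex can be added to one of them.

A vertex with almost all its neighbours on the forced paths would not see the random colours.  Only
the first and last two vertices of a path and the vertices of very short paths can be like this, and
the paths given to the colours are selected (by rounding a linear program and by passing to a sparse
subfamily) such that the harmful cases do not occur.
*)
Require Import Defs.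
From mathcomp Require Import all_boot all_order all_algebra zify lra.
From Stdlib Require Import Classical.
Set Implicit Arguments. Unset Strict Implicit. Unset Printing Implicit Defensive.

(** * Generalities and random colourings *)

(** Connectivity linear in [k * t] leaves no room for a union bound over the colours: a single
    colour fails with a probability that is small but need not tend to 0 as [t] grows. So only the
    expected number of failing colours is bounded, and twice as many colours as needed are provided.
    The second obstacle is that [D] and [#|V|] are not bounded in terms of [k * t]. Random tests are
    therefore made only for vertices not already served by hubs: O(D) free ones per colour, each
    with a number of useful free out-neighbours linear in [D], so that an error exponent of order
    [D / t] beats their number. Two selection devices are needed because rounding loses one path per
    constraint. It can protect the O(kt) vertices of very short paths, but not the path ends, which
    are four per path. The sparse subfamily protects only the ends of the paths that are selected;
    an end of another path may see nothing but forced vertices, and then it is placed where its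
    neighbours in [Mid] are frequent. *)

Lemma ex_min_nat (P : nat -> Prop) :
  (exists n, P n) -> exists n, P n /\ forall m, P m -> n <= m.
Proof.
case=> n; elim/ltn_ind: n => n IHn Pn.
case: (classic (exists m, P m /\ m < n)) => [[m [Pm mn]]|nP]; first exact: IHn mn Pm.
exists n; split=> // m Pm; rewrite leqNgt; apply/negP => mn.
by apply: nP; exists m.
Qed.

Lemma subset_of_card (T : finType) (A : {set T}) a :
  a <= #|A| -> exists2 B : {set T}, B \subset A & #|B| = a.
Proof.
move=> aA; exists [set x in take a (enum A)].
  by apply/subsetP => x; rewrite inE => /mem_take; rewrite mem_enum.
rewrite cardsE; have /card_uniqP -> : uniq (take a (enum A)) by rewrite take_uniq ?enum_uniq.
by rewrite size_take -cardE; case: ltngtP aA.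
Qed.

Lemma embed_into (I V : finType) (A : {set V}) :
  #|I| <= #|A| -> exists2 h : I -> V, injective h & forall i, h i \in A.
Proof.
move=> IA; exists (fun i => enum_val (widen_ord IA (enum_rank i))); last first.
  by move=> i; apply: enum_valP.
move=> i j /enum_val_inj /(congr1 val) /= /val_inj; exact: enum_rank_inj.
Qed.

Lemma card_gt_notin (V : finType) (A Z : {set V}) k :
  k <= #|A| -> #|Z| < k -> exists2 v, v \in A & v \notin Z.
Proof.
move=> kA Zk; have /card_gt0P [v] : 0 < #|A :\: Z|.
  have := cardsID Z A; have := subset_leq_card (subsetIr A Z); lia.
by rewrite inE => /andP [vZ vA]; exists v.
Qed.

Lemma sum_card_dep (I J : finType) (P : I -> J -> bool) :
  \sum_i #|[set j | P i j]| = \sum_j #|[set i | P i j]|.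
Proof.
transitivity (\sum_i \sum_j (P i j : nat)).
  by apply: eq_bigr => i _; rewrite -sum1dep_card big_mkcond.
by rewrite exchange_big; apply: eq_bigr => j _; rewrite -sum1dep_card [in RHS]big_mkcond.
Qed.

Lemma card_bigcup_le (I V : finType) (P : pred I) (F : I -> {set V}) :
  #|\bigcup_(i | P i) F i| <= \sum_(i | P i) #|F i|.
Proof.
elim/big_ind2: _ => [|m A n B mA nB|//]; first by rewrite cards0.
by apply: leq_trans (leq_card_setU _ _).1 (leq_add mA nB).
Qed.

Section Digraphs.
Variables (V : finType) (E : rel V).

Definition rv : rel V := fun u v => E v u.
Definition out v := [set w | E v w].

Lemma kconn_add (k : nat) (S A : {set V}) : 0 < k ->
  strongly_kconnected_on E k S ->
  (forall v, v \in A -> k <= #|out v :&: S| /\ k <= #|[set w | E w v] :&: S|) ->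
  strongly_kconnected_on E k (S :|: A).
Proof.
move=> k0 [kS conS] degA; split; first by apply: leq_trans kS (subset_leq_card (subsetUl _ _)).
move=> Z _ Zk u v uSA vSA.
pose R := (S :|: A) :\: Z.
have conn a b : a \in S :\: Z -> b \in S :\: Z -> connect (restrict_rel E R) a b.
  move=> aS bS; have SZ : S :\: (S :&: Z) = S :\: Z.
    by apply/setP => x; rewrite !inE; case: (x \in S); case: (x \in Z).
  have := conS (S :&: Z) (subsetIl _ _) (leq_ltn_trans (subset_leq_card (subsetIr _ _)) Zk) a b.
  rewrite SZ => /(_ aS bS); apply: connect_sub => x y /and3P [].
  rewrite !inE => /andP [xZ xS] /andP [yZ yS] Exy; apply: connect1.
  by rewrite /restrict_rel /R !inE xZ xS yZ yS Exy.
have [u' u'S uu'] : exists2 u', u' \in S :\: Z & connect (restrict_rel E R) u u'.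
  move: (uSA); rewrite !inE => /andP [uZ /orP [uS|uA]].
    by exists u; rewrite ?inE ?uZ ?uS.
  have [w] := card_gt_notin (degA u uA).1 Zk; rewrite !inE => /andP [Euw wS] wZ.
  exists w; rewrite ?inE ?wZ ?wS //; apply: connect1.
  by rewrite /restrict_rel /R !inE uZ uA orbT wZ wS Euw.
have [v' v'S vv'] : exists2 v', v' \in S :\: Z & connect (restrict_rel E R) v' v.
  move: (vSA); rewrite !inE => /andP [vZ /orP [vS|vA]].
    by exists v; rewrite ?inE ?vZ ?vS.
  have [w] := card_gt_notin (degA v vA).2 Zk; rewrite !inE => /andP [Ewv wS] wZ.
  exists w; rewrite ?inE ?wZ ?wS //; apply: connect1.
  by rewrite /restrict_rel /R !inE vZ vA orbT wZ wS Ewv.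
exact: connect_trans uu' (connect_trans (conn _ _ u'S v'S) vv').
Qed.

End Digraphs.

Lemma connect_restrict_rv (V : finType) (E : rel V) (S : {set V}) u v :
  connect (restrict_rel (rv E) S) u v = connect (restrict_rel E S) v u.
Proof.
transitivity (connect (fun x y => restrict_rel E S y x) u v); last exact: connect_rev.
by apply: eq_connect => x y; rewrite /restrict_rel /rv /= andbCA.
Qed.

(* In a tournament some vertex of W has in-degree at least (|W|-1)/2 inside W. *)
Lemma indegree_bound (V : finType) (E : rel V) (W S : {set V}) b :
  is_tournament E -> W \subset S ->
  (forall v, v \in W -> #|[set u in S | E u v]| <= b) -> #|W| <= b.*2.+1.
Proof.
move=> [irr tot] WS degW.
have sumin : \sum_(v in W) #|[set u in W | E u v]| <= #|W| * b.
  rewrite -sum_nat_const; apply: leq_sum => v vW; apply: leq_trans (degW v vW).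
  by apply: subset_leq_card; apply/subsetP => u; rewrite !inE => /andP [/(subsetP WS) -> ->].
have sumeq : \sum_(v in W) #|[set u in W | E u v]| = \sum_(v in W) #|[set u in W | E v u]|.
  transitivity (\sum_(v in W) \sum_(u in W) (E u v : nat)).
    apply: eq_bigr => v _; rewrite -sum1_card big_mkcond [in RHS]big_mkcond.
    by apply: eq_bigr => u _; rewrite !inE; case: (u \in W); case: (E u v).
  rewrite exchange_big; apply: eq_bigr => u _; rewrite -[in RHS]sum1_card big_mkcond [in RHS]big_mkcond.
  by apply: eq_bigr => v _; rewrite !inE; case: (v \in W); case: (E u v).
have sumall : \sum_(v in W) (#|[set u in W | E u v]| + #|[set u in W | E v u]|) = #|W| * #|W|.-1.
  rewrite -sum_nat_const; apply: eq_bigr => v vW.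
  have -> : #|W|.-1 = #|W :\ v| by rewrite (cardsD1 v W) vW.
  rewrite -cardsUI (_ : _ :&: _ = set0) ?cards0 ?addn0; last first.
    apply/setP => u; rewrite !inE; case: (eqVneq u v) => [->|/tot]; first by rewrite (negbTE (irr v)) !andbF.
    by case: (E u v); case: (E v u); rewrite ?andbF.
  apply: eq_card => u; rewrite !inE; case: (eqVneq u v) => [->|/tot].
    by rewrite (negbTE (irr v)) !andbF.
  by case: (E u v); case: (E v u); case: (u \in W).
rewrite big_split /= -sumeq in sumall.
have : #|W| * #|W|.-1 <= #|W| * b.*2 by lia.
by case: (posnP #|W|) => [-> //|W0]; rewrite leq_pmul2l //; lia.
Qed.

(** * Exponential moments of uniformly random colourings, written as counts *)

Section Counting.
Variables (V : finType) (T : nat).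
Implicit Types (A : {set V}) (f : {ffun V -> 'I_T}).

Definition cls f i := [set w | f w == i].

Lemma sum_ffun_prod (g : V -> 'I_T -> nat) :
  \sum_(f : {ffun V -> 'I_T}) \prod_w g w (f w) = \prod_w \sum_i g w i.
Proof. by rewrite (bigA_distr_bigA g). Qed.

(** Markov's inequality for the weight [2 ^ (#|A| - h)], where [h] is the number of vertices of [A]
    with a colour in [I]. The weight is a product over the vertices, and each vertex of [A]
    contributes the factor [#|I| + 2 * (T - #|I|)]. *)
Lemma moment A (I : {set 'I_T}) m :
  #|[set f : {ffun V -> 'I_T} | #|[set w in A | f w \in I]| < m]| * 2 ^ #|A|
    <= 2 ^ m * (T ^ (#|V| - #|A|) * (2 * T - #|I|) ^ #|A|).
Proof.
pose g w (i : 'I_T) := if w \in A then (if i \in I then 1 else 2) else 1.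
have prodE f : \prod_w g w (f w) = 2 ^ (#|A| - #|[set w in A | f w \in I]|).
  rewrite (bigID (mem A)) /= [X in _ * X]big1 ?muln1; last by move=> w /negbTE wA; rewrite /g wA.
  rewrite (bigID (fun w => f w \in I)) /= big1 ?mul1n; last by move=> w /andP [wA wI]; rewrite /g wA wI.
  rewrite (eq_bigr (fun=> 2)); last by move=> w /andP [wA /negbTE wI]; rewrite /g wA wI.
  rewrite prod_nat_const; congr (2 ^ _).
  have := cardsID [set w | f w \in I] A.
  have -> : A :&: [set w | f w \in I] = [set w in A | f w \in I] by apply/setP => w; rewrite !inE.
  have <- : #|A :\: [set w | f w \in I]| = #|(fun w => (w \in A) && (f w \notin I))|.
    by rewrite -cardsE; apply: eq_card => w; rewrite !inE andbC.
  by move=> <-; rewrite addKn.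
have sumE : \prod_w \sum_i g w i = T ^ (#|V| - #|A|) * (2 * T - #|I|) ^ #|A|.
  rewrite (bigID (mem A)) /= mulnC; congr (_ * _).
    rewrite (eq_bigr (fun=> T)); last first.
      by move=> w /negbTE wA; rewrite /g wA sum_nat_const card_ord muln1.
    rewrite prod_nat_const; congr (_ ^ _); rewrite -(cardsC A).
    by rewrite addKn -cardsE; apply: eq_card => w; rewrite !inE.
  rewrite (eq_bigr (fun=> 2 * T - #|I|)) ?prod_nat_const // => w wA; rewrite /g wA.
  rewrite (bigID (mem I)) /= (eq_bigr (fun=> 1)) ?sum1_card; last by move=> i ->.
  rewrite (eq_bigr (fun=> 2)) ?sum_nat_const; last by move=> i /negbTE ->.
  have := cardsC I; rewrite card_ord; have -> : #|[pred i | i \notin I]| = #|~: I|.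
    by apply: eq_card => i; rewrite !inE.
  by set a := #|I|; set b := #|~: I|; move: a b => a b; lia.
rewrite -sumE -sum_ffun_prod -sum1_card big_distrl /= big_distrr /= big_mkcond /=.
apply: leq_sum => f _; rewrite inE prodE; case: ifP => // Hm; rewrite mul1n -expnD leq_exp2l //.
by rewrite -leq_subLR leq_sub2l // ltnW.
Qed.

(* Recolouring v gives a T-to-one map, so that conditioning on f v = c costs a factor T. *)
Lemma condition_colour v (Q : pred {ffun V -> 'I_T}) c :
  (forall f f', (forall w, w != v -> f w = f' w) -> Q f = Q f') ->
  T * #|[set f : {ffun V -> 'I_T} | (f v == c) && Q f]| = #|[set f | Q f]|.
Proof.
move=> indep; pose upd f i : {ffun V -> 'I_T} := [ffun w => if w == v then i else f w].
pose h (p : 'I_T * {ffun V -> 'I_T}) := upd p.2 p.1.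
have hE i f w : upd f i w = if w == v then i else f w by rewrite ffunE.
have -> : T * #|[set f : {ffun V -> 'I_T} | (f v == c) && Q f]| = #|setX [set: 'I_T] [set f : {ffun V -> 'I_T} | (f v == c) && Q f]|.
  by rewrite cardsX cardsT card_ord.
rewrite -(card_in_imset (f := h)); last first.
  move=> [i f] [i' f'] /=; rewrite !inE /= => /andP [/eqP fc _] /andP [/eqP f'c _] /ffunP eq.
  have -> : i = i' by have := eq v; rewrite !hE eqxx.
  congr (_, _); apply/ffunP => w; have := eq w; rewrite !hE.
  by case: eqP => [->|//]; rewrite fc f'c.
apply: eq_card => f; rewrite inE; apply/imsetP/idP.
  move=> [[i f']]; rewrite !inE /= => /andP [_ Qf'] ->; rewrite -(indep f') // => w /negbTE wv.
  by rewrite hE wv.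
move=> Qf; exists (f v, upd f c).
  rewrite !inE /= hE eqxx eqxx /= -(indep f) // => w /negbTE wv; by rewrite hE wv.
by apply/ffunP => w; rewrite !hE; case: eqP => [->|].
Qed.

Definition hits k f A i := k <= #|A :&: cls f i|.

(** Bernoulli's inequality [(1 + 1/m)^j >= 1 + j/m], multiplied out, for [m = N - 1] and [j = N]. *)
Lemma bernoulli_half N : 0 < N -> N.-1 ^ N * 2 <= N ^ N.
Proof.
case: N => // m _ /=; case: (posnP m) => [->|m0]; first by rewrite exp0n.
have bern j : m ^ j * (m + j) <= m * m.+1 ^ j.
  elim: j => [|j IHj]; first by rewrite !expn0; lia.
  by rewrite !expnS; move: (m ^ j) (m.+1 ^ j) IHj => x y; nia.
rewrite -(leq_pmul2l m0); apply: leq_trans (bern m.+1).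
by move: (m ^ m.+1) => x; nia.
Qed.

Lemma pow_ratio a b N m : a ^ N * 2 <= b ^ N -> a ^ (N * m) * 2 ^ m <= b ^ (N * m).
Proof. by move=> H; rewrite !expnM -expnMn; case: m => [|m] //; rewrite leq_exp2r. Qed.

Lemma card_ffun_ord : #|{ffun V -> 'I_T}| = T ^ #|V|.
Proof. by rewrite card_ffun card_ord. Qed.

(** Each block of [N] vertices halves the moment, so [j] blocks give failure probability at most
    [2^(m-j)]. Cutting [A] down to exactly [N * j] vertices only enlarges the set of failing
    colourings. *)
Lemma moment_ratio A (I : {set 'I_T}) m N j :
  0 < T -> 0 < N -> (2 * T - #|I|) ^ N * 2 <= (2 * T) ^ N -> N * j <= #|A| ->
  #|[set f : {ffun V -> 'I_T} | #|[set w in A | f w \in I]| < m]| * 2 ^ j <= 2 ^ m * T ^ #|V|.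
Proof.
move=> T0 N0 ratio NjA.
have [B BA cB] := subset_of_card NjA.
have := moment B I m; rewrite cB.
set c0 := #|_| => mom; set c1 := #|_|.
have c10 : c1 <= c0.
  apply: subset_leq_card; apply/subsetP => f; rewrite !inE; apply: leq_ltn_trans.
  by apply: subset_leq_card; apply/subsetP => w; rewrite !inE => /andP [/(subsetP BA) -> ->].
have NjV : N * j <= #|V| by rewrite -cB max_card.
have P0 : 0 < 2 ^ (N * j) by rewrite expn_gt0.
rewrite -(leq_pmul2r P0).
apply: (@leq_trans (c0 * 2 ^ (N * j) * 2 ^ j)); first by rewrite mulnAC leq_mul // leq_mul.
apply: (leq_trans (leq_mul mom (leqnn _))).
rewrite -!mulnA leq_mul // -[in X in _ <= X](subnK NjV) expnD -!mulnA leq_mul //.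
by rewrite -expnMn [T * 2]mulnC; apply: pow_ratio.
Qed.

Lemma miss_bound k j A i : 0 < T -> 2 * T * j <= #|A| ->
  #|[set f : {ffun V -> 'I_T} | ~~ hits k f A i]| * 2 ^ j <= 2 ^ k * T ^ #|V|.
Proof.
move=> T0 TjA; have := @moment_ratio A [set i] k (2 * T) j T0.
rewrite cards1 => /(_ _ _ TjA) H; apply: leq_trans (H _ _); rewrite ?muln_gt0 ?T0 //.
  rewrite leq_mul //; apply: subset_leq_card; apply/subsetP => f; rewrite !inE /hits -ltnNge.
  apply: leq_ltn_trans; apply: subset_leq_card; apply/subsetP => w; rewrite !inE.
  by move=> /andP [-> ->].
by rewrite subn1; apply: bernoulli_half; rewrite muln_gt0 T0.
Qed.

Lemma miss_bound_cond k j A i v c : 0 < T -> v \notin A -> 2 * T * j <= #|A| ->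
  T * #|[set f : {ffun V -> 'I_T} | (f v == c) && ~~ hits k f A i]| * 2 ^ j <= 2 ^ k * T ^ #|V|.
Proof.
move=> T0 vA TjA; rewrite condition_colour; first exact: miss_bound.
move=> f f' ff'; rewrite /hits; congr (~~ (_ <= #|pred_of_set _|)).
apply/setP => w; rewrite !inE; case wA: (w \in A) => //=; rewrite ff' //.
by apply: contraNneq vA => <-.
Qed.

(** Four squarings, with the fraction rounded up to keep the numerals small: 15/16, 8/9, 4/5, 16/25,
    1/2. *)
Lemma fifteen_sixteenths a b : 16 * a <= 15 * b -> a ^ 16 * 2 <= b ^ 16.
Proof.
have sq p q x y : p * x <= q * y -> p * p * x ^ 2 <= q * q * y ^ 2.
  by move=> H; have := leq_mul H H; rewrite !expnS !expn0; nia.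
move=> H1; have := sq _ _ _ _ H1.
rewrite (expnM _ 2 8) (expnM b 2 8); move: (a ^ 2) (b ^ 2) => {H1}a {}b H.
have H1 : 9 * a <= 8 * b by lia.
move: {H}(sq _ _ _ _ H1).
rewrite (expnM _ 2 4) (expnM b 2 4); move: (a ^ 2) (b ^ 2) => {H1}a {}b H.
have H1 : 5 * a <= 4 * b by lia.
move: {H}(sq _ _ _ _ H1).
rewrite (expnM _ 2 2) (expnM b 2 2); move: (a ^ 2) (b ^ 2) => {H1}a {}b H.
by move: (sq _ _ _ _ H); lia.
Qed.

(* A union bound over the set of colours that are missed. *)
Lemma many_misses k j A : 0 < T -> 16 * j <= #|A| ->
  #|[set f : {ffun V -> 'I_T} | T <= 8 * #|[set i | ~~ hits k f A i]|]| * 2 ^ j <= 2 ^ (T + k * T) * T ^ #|V|.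
Proof.
move=> T0 jA; pose F (I : {set 'I_T}) :=
  [set f : {ffun V -> 'I_T} | (T <= 8 * #|I|) && (#|[set w in A | f w \in I]| < k * #|I|)].
have FI I : #|F I| * 2 ^ j <= 2 ^ (k * T) * T ^ #|V|.
  case: (leqP T (8 * #|I|)) => [TI|TI]; last first.
    by rewrite (_ : F I = set0) ?cards0 //; apply/setP => f; rewrite !inE leqNgt TI.
  have -> : F I = [set f : {ffun V -> 'I_T} | #|[set w in A | f w \in I]| < k * #|I|].
    by apply/setP => f; rewrite !inE TI.
  have IT : #|I| <= T by have := max_card (mem I); rewrite card_ord.
  apply: leq_trans (_ : 2 ^ (k * #|I|) * T ^ #|V| <= _); last first.
    by rewrite leq_mul // leq_exp2l // leq_mul.
  (* Since [#|I| >= T / 8], the ratio [(2T - #|I|) / 2T] is at most 15/16; hence blocks of 16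
     vertices. *)
  apply: (@moment_ratio _ _ _ 16) => //.
  by apply: fifteen_sixteenths; lia.
have sub : [set f | T <= 8 * #|[set i | ~~ hits k f A i]|] \subset \bigcup_(I : {set 'I_T}) F I.
  apply/subsetP => f; rewrite inE => Hf; apply/bigcupP; exists [set i | ~~ hits k f A i] => //.
  rewrite inE Hf /=; set I := [set i | _] in Hf *.
  have I0 : 0 < #|I| by lia.
  have -> : #|[set w in A | f w \in I]| = \sum_(i in I) #|A :&: cls f i|.
    rewrite -sum1_card (partition_big f (mem I)) /=; last by move=> w; rewrite !inE => /andP [].
    apply: eq_bigr => i iI; rewrite -sum1_card; apply: eq_bigl => w; rewrite !inE.
    by case: eqP => [->|]; rewrite ?andbF // !inE in iI *; rewrite iI !andbT.
  have : \sum_(i in I) (#|A :&: cls f i|.+1) <= \sum_(i in I) k.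
    by apply: leq_sum => i; rewrite inE -ltnNge.
  rewrite sum_nat_const (eq_bigr (fun i => #|A :&: cls f i| + 1)); last by move=> ? _; rewrite addn1.
  by rewrite big_split /= sum1_card mulnC => H; apply: leq_trans H; rewrite -addn1 leq_add2l.
apply: (leq_trans (leq_mul (subset_leq_card sub) (leqnn _))).
apply: (leq_trans (leq_mul (card_bigcup_le _ _) (leqnn _))) => /=.
rewrite big_distrl /=; apply: (@leq_trans (\sum_(I : {set 'I_T}) 2 ^ (k * T) * T ^ #|V|)).
  by apply: leq_sum.
have cP : #|[set: {set 'I_T}]| = 2 ^ T by rewrite -powersetT card_powerset cardsT card_ord.
rewrite sum_nat_const -[X in X * _]cardsE expnD -mulnA leq_mul // -cP.
by apply: subset_leq_card; apply/subsetP => I; rewrite !inE.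
Qed.

End Counting.

(** * One direction of a colour class *)

Definition trunc (V : finType) a (A : {set V}) := [set x in take a (enum A)].

Lemma trunc_sub (V : finType) a (A : {set V}) : trunc a A \subset A.
Proof. by apply/subsetP => x; rewrite inE => /mem_take; rewrite mem_enum. Qed.

Lemma card_trunc (V : finType) a (A : {set V}) : a <= #|A| -> #|trunc a A| = a.
Proof.
move=> aA; rewrite cardsE; have /card_uniqP -> : uniq (take a (enum A)) by rewrite take_uniq ?enum_uniq.
by rewrite size_take -cardE; case: ltngtP aA.
Qed.

Lemma linear_le_exp m q : 30 <= q -> m <= (30 * 1024) -> m * q <= 2 ^ q.
Proof.
move=> q30 m30; rewrite -(subnK q30); move: (q - 30) => r; rewrite expnD.
have r2 := ltn_expl r (ltnSn 1).
have -> : 2 ^ 30 = 1024 * 1024 * 1024 by rewrite (expnD 2 20 10) (expnD 2 10 10).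
move: (2 ^ r) r2 => x r2; apply: (@leq_trans ((30 * 1024) * (r + 30))); first by rewrite leq_mul.
lia.
Qed.

Lemma cubic_le_exp k : 0 < k -> (82 * 1024) * (k * k * k) <= 2 ^ (30 * k).
Proof.
move=> k0; have k2 := ltnW (ltn_expl k (ltnSn 1)).
apply: (@leq_trans (2 ^ (20 * k) * (2 ^ k * 2 ^ k * 2 ^ k))); last first.
  by rewrite -!expnD leq_exp2l //; lia.
apply: leq_mul; last by rewrite !leq_mul.
apply: (@leq_trans (2 ^ 20)); last by rewrite leq_exp2l //; lia.
by rewrite (expnD 2 10 10); have -> : 2 ^ 10 = 1024 by []; lia.
Qed.

Lemma card_le_setU (V : finType) (A B C : {set V}) :
  A \subset B :|: C -> #|A| <= #|B| + #|C|.
Proof. by move=> /subset_leq_card /leq_trans -> //; apply: (leq_card_setU _ _).1. Qed.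

(* The set-up is described from one side; the other side is obtained by reversing all edges and
   exchanging the hubs U and W.  L i is the set of vertices forced into part i: the hubs U i, W i and
   the paths P i j.  Mid consists of path vertices joined to all hubs in the good direction, and the
   vertices of the small set Cs, which contains the hubs and the starts st i j, need individual care. *)
Section HalfDef.
Variables (V : finType) (T k : nat) (P : 'I_T -> 'I_k -> seq V) (L : 'I_T -> {set V}) (Cs Mid : {set V}).

Definition forced := \bigcup_i L i.
Definition free := ~: (forced :|: Cs).
Definition to_all (E : rel V) (U : 'I_T -> {set V}) v := forall i u, u \in U i -> E v u.

(** In the first case the [k] disjoint paths of a part supply [k] out-neighbours in that part which
    all dominate the hubs; in the second the hubs themselves are out-neighbours; in the third enough
    out-neighbours are unforced for the random colouring to be seen. *)
Definition cared (E : rel V) (U : 'I_T -> {set V}) (K : nat) v :=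
  [\/ forall i j, exists2 q, q \in P i j & E v q && (q \in Mid),
      to_all E U v | K <= 4 * #|out E v :\: forced|].

Record side (E : rel V) (U : 'I_T -> {set V}) (st : 'I_T -> 'I_k -> V) (K D b : nat) : Prop := Side {
  h_tour : is_tournament E;
  h_deg : forall v, K <= #|out E v|;
  h_low : forall i u, u \in U i -> #|out E u| <= D;
  h_start : forall i j, #|out E (st i j)| <= D;
  h_startC : forall i j, st i j \in Cs;
  h_high : forall v, v \notin Cs -> D <= #|out E v|;
  h_hub : forall i u, u \in U i -> #|out E u :&: forced| <= b;
  h_free : forall v, v \notin Cs -> v \notin forced -> to_all E U v \/ #|out E v :&: forced| <= b;
  h_mid : forall v, v \in Mid -> to_all E U v;
  h_care : forall v, v \in forced -> v \in Cs -> cared E U K v;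
  h_UL : forall i, U i \subset L i;
  h_UC : forall i, U i \subset Cs;
  h_Usize : forall i, #|U i| = 21 * k }.

End HalfDef.

(** * Expected number of failing colours, for one direction *)

Section HalfCount.
Variables (V : finType) (T t k : nat).
Variables (P : 'I_T -> 'I_k -> seq V) (L : 'I_T -> {set V}) (Cs Mid : {set V}).
Variables (E : rel V) (U : 'I_T -> {set V}) (st : 'I_T -> 'I_k -> V) (K D b : nat).
Hypothesis k0 : 0 < k.
Hypothesis t0 : 0 < t.
Hypothesis TE : T = 2 * t.
Hypothesis hE : side P L Cs Mid E U st K D b.
Hypothesis Cs_small : #|Cs| <= 1200 * (k * t).
Hypothesis b_small : b <= 100 * (k * t).
Hypothesis K_large : 100 * 1000 * (k * t) <= K.
Hypothesis L_disj : forall i i' v, v \in L i -> v \in L i' -> i = i'.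

Local Notation out := (out E).
Local Notation forced := (forced L).
Local Notation G := (free L Cs).
Local Notation tot := (T ^ #|V|).

Let T0 : 0 < T. Proof. by rewrite TE; lia. Qed.
Let kt0 : 0 < k * t. Proof. by rewrite muln_gt0 k0. Qed.

Lemma edge_asym u v : E u v -> E v u = false.
Proof.
have [irr tot] := h_tour hE; case: (eqVneq u v) => [->|/tot]; first by rewrite (negbTE (irr v)).
by case: (E u v) => //; case: (E v u).
Qed.

Lemma edge_total u v : u != v -> ~~ E u v -> E v u.
Proof. by have [_ tot] := h_tour hE; move=> /tot; case: (E u v) => //=; case: (E v u). Qed.

Lemma D_large : K <= D.
Proof.
have i0 : 'I_T by apply: Ordinal T0.
have /card_gt0P [u uU] : 0 < #|U i0| by rewrite (h_Usize hE); lia.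
exact: leq_trans (h_deg hE u) (h_low hE uU).
Qed.

Lemma free_notin v : v \in G -> (v \notin forced) /\ (v \notin Cs).
Proof. by rewrite !inE negb_or => /andP []. Qed.

(* A free vertex of colour i outside S0 i has k out-neighbours in U i; one in S0 i \ S1 i goes through
   free vertices outside S0 i, and one in S1 i through free vertices outside S1 i.  S1 i is small: |S0 i|
   is hardly larger than D, so the vertices of S1 i beat almost all of S0 i. *)
Definition S0 i := [set v in G | #|out v :&: U i| < k].
Definition S1 i := [set v in S0 i | 20 * #|out v :\: S0 i| < D].
Definition A1 v i := (out v :&: G) :\: (if v \in S1 i then S1 i else S0 i).
Definition C2 i := [set v in Cs :&: L i | K <= 4 * #|out v :\: forced|].
(* All but the weak vertices have an edge or at least K/8 paths of length 2 to x. *)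
Definition weak x := [set w in G | E x w && (8 * #|out w :\: out x| < K)].
(** Truncated because the elements of this set not adjacent to [x] are tested one by one, so their
    number must be O(Tk). The 31 is 1 for the [k] hits and 30 for the error [2^(-30k)]. *)
Definition A3 u x := trunc (2 * T * (31 * k)) ((out u :&: G) :\: weak x).
Definition A4 w x := (out w :&: [set y | E y x]) :&: G.

Definition good (f : {ffun V -> 'I_T}) i :=
  [&& [forall (v | (v \in S0 i) && (f v == i)), hits k f (A1 v i) i],
      [forall (v | v \in C2 i), hits k f (out v :&: G) i] &
      [forall (u | u \in U i), forall j,
        hits k f (A3 u (st i j)) i &&
        [forall (w | w \in A3 u (st i j)),
           (~~ E w (st i j) && (f w == i)) ==> hits k f (A4 w (st i j)) i]]].

(* The vertices that may see k free out-neighbours in too few colours. *)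
Definition C4 := [set v in Cs | K <= 4 * #|out v :\: forced|].
Definition B4 := [set v in G | T <= 8 * #|[set i | v \in S0 i]|].
Definition few (f : {ffun V -> 'I_T}) v := T <= 8 * #|[set i | ~~ hits k f (out v :&: G) i]|.

Lemma card_out_free v c : #|out v :&: forced| <= c -> #|out v| <= #|out v :&: G| + c + #|Cs|.
Proof.
move=> cv; have : out v \subset ((out v :&: G) :|: (out v :&: forced)) :|: Cs.
  by apply/subsetP => w; rewrite !inE => ->; case: (w \in Cs); case: (w \in forced).
move=> /card_le_setU; have := (leq_card_setU (out v :&: G) (out v :&: forced)).1; lia.
Qed.

(** Double counting of the edges from [U i] to [S0 i]: a vertex of [S0 i] beats fewer than [k] of
    the [21 * k] hubs, so it is beaten by more than [20 * k], while each hub has at most [D]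
    out-neighbours. The many hubs bring the ratio down to 21/20. *)
Lemma card_S0 i : 20 * #|S0 i| <= 21 * D.
Proof.
have H : \sum_(u in U i) #|out u| <= #|U i| * D.
  by rewrite -sum_nat_const; apply: leq_sum => u uU; apply: (h_low hE uU).
have : \sum_(v in S0 i) (20 * k) <= \sum_(v in S0 i) #|[set u in U i | E u v]|.
  apply: leq_sum => v; rewrite inE => /andP [/free_notin [_ vC] vk].
  have := cardsID (out v) (U i); rewrite (h_Usize hE) setIC => e.
  have : U i :\: out v \subset [set u in U i | E u v].
    apply/subsetP => u; rewrite !inE => /andP [nvu uU]; rewrite uU /=; apply: edge_total nvu.
    by apply: contraNneq vC => ->; apply: (subsetP (h_UC hE i)).
  move=> /subset_leq_card; lia.
rewrite sum_nat_const => H1.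
have H2 : \sum_(v in S0 i) #|[set u in U i | E u v]| <= \sum_(u in U i) #|out u|.
  apply: (@leq_trans (\sum_v #|[set u in U i | E u v]|)).
    by rewrite [X in _ <= X](bigID (mem (S0 i))) /= leq_addr.
  rewrite (sum_card_dep (fun v u => (u \in U i) && E u v)) [X in _ <= X]big_mkcond.
  apply: leq_sum => u _; case: ifP => uU.
    by apply: subset_leq_card; apply/subsetP => v; rewrite !inE => /andP [].
  by rewrite leqn0 cards_eq0; apply/eqP/setP => v; rewrite !inE.
rewrite (h_Usize hE) in H.
rewrite -(leq_pmul2l k0); move: (leq_trans H1 (leq_trans H2 H)); lia.
Qed.

Lemma S1_sub i : S1 i \subset S0 i.
Proof. by apply/subsetP => v; rewrite inE => /andP []. Qed.

Lemma S0_free i v : v \in S0 i -> v \in G.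
Proof. by rewrite inE => /andP []. Qed.

Lemma S0_not_all i v : v \in S0 i -> #|out v :&: forced| <= b.
Proof.
rewrite inE => /andP [vG vk]; have [vF vC] := free_notin vG.
have [all|//] := h_free hE vC vF; move: vk; rewrite (setIidPr _) ?(h_Usize hE); first lia.
by apply/subsetP => u uU; rewrite inE; apply: all uU.
Qed.

(** A vertex of [S1 i] has more than 19D/20 out-neighbours among the at most 21D/20 vertices of
    [S0 i], hence in-degree about D/10 at most there. By [indegree_bound] there are only about D/5
    such vertices. *)
Lemma card_S1 i : 4 * #|S1 i| <= D.
Proof.
have := D_large; have S0D := card_S0 i => KD.
have : #|S1 i| <= (#|S0 i| - (D - D %/ 20)).*2.+1.
  apply: (indegree_bound (h_tour hE) (S1_sub i)) => v.
  rewrite inE => /andP [vS0 vD].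
  have [_ vC] := free_notin (S0_free vS0).
  have := h_high hE vC; have := cardsID (S0 i) (out v).
  have : #|out v :&: S0 i| + #|[set u in S0 i | E u v]| <= #|S0 i|.
    rewrite -cardsUI [X in _ + X](_ : _ = 0) ?addn0; last first.
      apply/eqP; rewrite cards_eq0; apply/eqP/setP => u; rewrite !inE.
      by case: (boolP (E v u)) => // /edge_asym ->; rewrite !andbF.
    by apply: subset_leq_card; apply/subsetP => u; rewrite !inE => /orP [] /andP [].
  lia.
lia.
Qed.

(** The same argument inside [out x]: a weak vertex has at least [D] out-neighbours, all but K/8 of
    them in [out x], which has size at most [D]. *)
Lemma card_weak x : x \in Cs -> #|out x| <= D -> 4 * #|weak x| <= K + 4.
Proof.
move=> xC xD.
have : #|weak x| <= (K %/ 8).*2.+1.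
  have sub : weak x \subset out x by apply/subsetP => w; rewrite !inE => /and3P [].
  apply: (indegree_bound (h_tour hE) sub) => w.
  rewrite inE => /and3P [wG xw wK].
  have [_ wC] := free_notin wG; have := h_high hE wC; have := cardsID (out x) (out w).
  have : #|out w :&: out x| + #|[set u in out x | E u w]| <= #|out x|.
    rewrite -cardsUI [X in _ + X](_ : _ = 0) ?addn0; last first.
      apply/eqP; rewrite cards_eq0; apply/eqP/setP => u; rewrite !inE.
      by case: (boolP (E w u)) => // /edge_asym ->; rewrite !andbF.
    by apply: subset_leq_card; apply/subsetP => u; rewrite !inE => /orP [] /andP [].
  lia.
lia.
Qed.

(** Outside the removed set [v] has about 3D/4 or at least D/20 out-neighbours. Forced vertices and
    [Cs] take at most 1300kt of them, which is below D/40 as D is at least 100000kt. *)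
Lemma card_A1 v i : v \in S0 i -> D <= 40 * #|A1 v i|.
Proof.
move=> vS0; have KD := D_large; have vb := S0_not_all vS0.
have [_ vC] := free_notin (S0_free vS0).
have cov X : out v :\: X \subset ((out v :&: G) :\: X) :|: ((out v :&: forced) :|: Cs).
  by apply/subsetP => w; rewrite !inE => /andP [-> ->]; case: (w \in Cs); case: (w \in forced).
have cov' X : #|out v :\: X| <= #|(out v :&: G) :\: X| + b + #|Cs|.
  have := card_le_setU (cov X); have := (leq_card_setU (out v :&: forced) Cs).1; lia.
rewrite /A1; case: ifP => [vS1|vS1].
  have := cov' (S1 i); have := card_S1 i; have := h_high hE vC; have := cardsID (S1 i) (out v).
  have := subset_leq_card (subsetIr (out v) (S1 i)); lia.
have := cov' (S0 i); move: vS1; rewrite inE vS0 /=; lia.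
Qed.

Lemma card_out_unforced v : K <= 4 * #|out v :\: forced| -> K <= 8 * #|out v :&: G|.
Proof.
have cov : out v :\: forced \subset (out v :&: G) :|: Cs.
  by apply/subsetP => w; rewrite !inE => /andP [/negbTE -> ->]; case: (w \in Cs).
by have := card_le_setU cov; lia.
Qed.

Lemma card_A3 i u x : u \in U i -> x \in Cs -> #|out x| <= D -> #|A3 u x| = 2 * T * (31 * k).
Proof.
move=> uU xC xD; apply: card_trunc.
have := card_weak xC xD; have := card_out_free (h_hub hE uU); have := h_deg hE u.
have := cardsID (weak x) (out u :&: G); have := subset_leq_card (subsetIr (out u :&: G) (weak x)).
lia.
Qed.

(** As the hub [u] beats [w], the vertex [w] does not dominate all hubs, so [h_free] leaves it at
    most [b] forced out-neighbours. It is not weak, so K/8 of its out-neighbours avoid [out x], and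
    these beat [x]. *)
Lemma card_A4 i u w x : u \in U i -> w \in A3 u x -> ~~ E w x -> x \in Cs -> K <= 16 * #|A4 w x|.
Proof.
move=> uU /(subsetP (trunc_sub _ _)); rewrite !in_setD !in_setI.
move=> /andP [wweak /andP [uw wG]] wx xC; have [wF wC] := free_notin wG.
have xw : E x w by apply: edge_total wx; apply: contraNneq wC => ->.
have wb : #|out w :&: forced| <= b.
  have [all|//] := h_free hE wC wF; have := all _ _ uU.
  by rewrite inE in uw; rewrite edge_asym.
have cov : out w :\: out x \subset A4 w x :|: ((out w :&: forced) :|: Cs).
  apply/subsetP => y; rewrite !inE => /andP [nxy wy].
  have -> : E y x by apply: edge_total nxy; apply: contraNneq wx => ->.
  by rewrite wy; case: (y \in Cs); case: (y \in forced).
have := card_le_setU cov; have := (leq_card_setU (out w :&: forced) Cs).1.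
move: wweak; rewrite inE wG xw /=; lia.
Qed.

Lemma miss_J (A : {set V}) i : 2 * T * (31 * k) <= #|A| ->
  #|[set f : {ffun V -> 'I_T} | ~~ hits k f A i]| * 2 ^ (30 * k) <= tot.
Proof.
move=> HA; have := miss_bound k i T0 HA.
have -> : 31 * k = k + 30 * k by lia.
by rewrite expnD mulnCA leq_pmul2l ?expn_gt0.
Qed.

Lemma miss_cond (A : {set V}) i v q : v \notin A -> 2 * T * (k + q) <= #|A| ->
  T * #|[set f : {ffun V -> 'I_T} | (f v == i) && ~~ hits k f A i]| * 2 ^ q <= tot.
Proof.
move=> vA HA; have := miss_bound_cond k i i T0 vA HA.
by rewrite expnD mulnCA leq_pmul2l ?expn_gt0.
Qed.

Lemma bad1 : 64 * \sum_i \sum_(v in S0 i)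
  #|[set f : {ffun V -> 'I_T} | (f v == i) && ~~ hits k f (A1 v i) i]| <= T * tot.
Proof.
have KD := D_large.
(* The largest exponent for which [2 * T * (k + q)] is at most D/40, the guaranteed size of [A1]. It
   must grow with [D], because up to 2D vertices are tested for each colour. *)
pose q := D %/ (80 * T) - k.
have q30 : 30 * k <= q.
  have : 31 * k <= D %/ (80 * T) by rewrite leq_divRL; lia.
  rewrite /q; lia.
have Dup : D < 80 * T * (k + q).+1.
  have := ltn_ceil D (_ : 0 < 80 * T); rewrite muln_gt0 T0 => /(_ isT).
  by have <- : (k + q).+1 = (D %/ (80 * T)).+1; [rewrite /q in q30 *; lia | rewrite mulnC].
have Dlo : 80 * T * (k + q) <= D.
  have -> : k + q = D %/ (80 * T) by rewrite /q in q30 *; lia.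
  by rewrite mulnC; apply: leq_trunc_div.
have qe : 128 * (80 * (k + q).+1) <= 2 ^ q.
  apply: leq_trans (@linear_le_exp (30 * 1024) q _ _); lia.
have each i v : v \in S0 i ->
  #|[set f : {ffun V -> 'I_T} | (f v == i) && ~~ hits k f (A1 v i) i]| * (T * 2 ^ q) <= tot.
  move=> vS0; rewrite mulnCA mulnA; apply: miss_cond.
    by rewrite /A1 !inE (negbTE ((h_tour hE).1 v)) ?andbF.
  have := card_A1 vS0; lia.
have P0 : 0 < T * 2 ^ q by rewrite muln_gt0 T0 expn_gt0.
rewrite -(leq_pmul2r P0) -mulnA big_distrl /=.
apply: (@leq_trans (64 * \sum_(i : 'I_T) 2 * D * tot)).
  rewrite leq_mul //; apply: leq_sum => i _; rewrite big_distrl /=.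
  apply: (@leq_trans (\sum_(v in S0 i) tot)); first by apply: leq_sum => v; apply: each.
  by rewrite sum_nat_const leq_mul //; have := card_S0 i; lia.
rewrite sum_nat_const card_ord.
have : 128 * D <= T * 2 ^ q.
  apply: (@leq_trans (T * (128 * (80 * (k + q).+1)))); last by rewrite leq_mul.
  lia.
move: tot (2 ^ q) => x y; nia.
Qed.

Lemma sum_C2 : \sum_i #|C2 i| <= #|Cs|.
Proof.
apply: (@leq_trans (\sum_i #|[set v | (v \in Cs) && (v \in L i)]|)).
  apply: leq_sum => i _; apply: subset_leq_card; apply/subsetP => v.
  by rewrite !inE => /andP [/andP [-> ->]].
rewrite (sum_card_dep (fun i v => (v \in Cs) && (v \in L i))) -sum1_card [X in _ <= X]big_mkcond.
apply: leq_sum => v _; case: ifP => vC; last first.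
  by rewrite leqn0 cards_eq0; apply/eqP/setP => i; rewrite !inE.
apply: (leq_trans (_ : _ <= 1)) => //.
by apply/card_le1P => i; rewrite inE /= => vi j; rewrite !inE; apply/idP/eqP => [vj|->//]; apply: L_disj vj vi.
Qed.

(** By disjointness of the sets [L i] a vertex of [Cs] is tested for one colour only. That makes
    600k tests per colour on average, against an error of [2^(-30k)]. *)
Lemma bad2 : 64 * \sum_i \sum_(v in C2 i)
  #|[set f : {ffun V -> 'I_T} | ~~ hits k f (out v :&: G) i]| <= T * tot.
Proof.
have P0 : 0 < 2 ^ (30 * k) by rewrite expn_gt0.
rewrite -(leq_pmul2r P0) -mulnA big_distrl /=.
apply: (@leq_trans (64 * \sum_i #|C2 i| * tot)).
  rewrite leq_mul //; apply: leq_sum => i _; rewrite big_distrl /= -sum_nat_const.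
  apply: leq_sum => v; rewrite inE => /andP [_ /card_out_unforced vK]; apply: miss_J.
  by lia.
rewrite -big_distrl /=.
have := cubic_le_exp k0; have H2 := leq_trans sum_C2 Cs_small.
move: H2; move: (\sum_i _) (2 ^ _) tot => s x y H2 H1.
have H3 : k <= k * k * k by nia.
have H4 : 64 * s <= T * x by move: (k * k * k) H1 H3 => m; nia.
rewrite mulnA [X in _ <= X]mulnAC; exact: leq_mul.
Qed.

Lemma bad3 : 64 * \sum_i \sum_(u in U i) \sum_j
  #|[set f : {ffun V -> 'I_T} | ~~ hits k f (A3 u (st i j)) i]| <= T * tot.
Proof.
have P0 : 0 < 2 ^ (30 * k) by rewrite expn_gt0.
rewrite -(leq_pmul2r P0) -mulnA big_distrl /=.
apply: (@leq_trans (64 * \sum_(i : 'I_T) 21 * k * k * tot)).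
  apply: leq_mul => //; apply: leq_sum => i _; rewrite big_distrl /=.
  apply: (@leq_trans (\sum_(u in U i) k * tot)); last by rewrite sum_nat_const (h_Usize hE) !mulnA.
  apply: leq_sum => u uU; rewrite big_distrl /=.
  apply: (@leq_trans (\sum_(j < k) tot)); last by rewrite sum_nat_const card_ord.
  apply: leq_sum => j _; apply: miss_J.
  by rewrite (card_A3 uU) ?(h_startC hE) ?(h_start hE).
rewrite sum_nat_const card_ord.
have := cubic_le_exp k0; have : k * k <= k * k * k by nia.
move: (2 ^ _) tot (k * k * k) => x y z H1 H2.
have : 1344 * (k * k) <= x by lia.
move: (k * k) => m; nia.
Qed.

(** The size of [A3] is proportional to [T]; the probability 1/T of the event [f w == i] cancels
    this factor. *)
Lemma bad4 : 64 * \sum_i \sum_(u in U i) \sum_j \sum_(w in A3 u (st i j) | ~~ E w (st i j))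
  #|[set f : {ffun V -> 'I_T} | (f w == i) && ~~ hits k f (A4 w (st i j)) i]| <= T * tot.
Proof.
have P0 : 0 < T * 2 ^ (30 * k) by rewrite muln_gt0 T0 expn_gt0.
rewrite -(leq_pmul2r P0) -mulnA big_distrl /=.
apply: (@leq_trans (64 * \sum_(i : 'I_T) 21 * k * (k * (2 * T * (31 * k) * tot)))).
  apply: leq_mul => //; apply: leq_sum => i _; rewrite big_distrl /=.
  apply: (@leq_trans (\sum_(u in U i) k * (2 * T * (31 * k) * tot))); last first.
    by rewrite sum_nat_const (h_Usize hE).
  apply: leq_sum => u uU; rewrite big_distrl /=.
  apply: (@leq_trans (\sum_(j < k) (2 * T * (31 * k) * tot))); last by rewrite sum_nat_const card_ord.
  apply: leq_sum => j _; rewrite big_distrl /=.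
  rewrite -(card_A3 uU (h_startC hE i j) (h_start hE i j)) -sum_nat_const.
  rewrite [X in _ <= X](bigID (fun w => ~~ E w (st i j))) /=.
  apply: leq_trans (leq_addr _ _); apply: leq_sum => w /andP [wA3 wx].
  rewrite mulnCA mulnA; apply: miss_cond; first by rewrite /A4 !inE (negbTE ((h_tour hE).1 w)).
  have := card_A4 uU wA3 wx (h_startC hE i j); lia.
rewrite sum_nat_const card_ord.
have := cubic_le_exp k0; move: (2 ^ _) tot => x y H.
apply: (@leq_trans (T * T * ((82 * 1024) * (k * k * k)) * y)); first nia.
by rewrite [X in _ <= X]mulnACA [y * x]mulnC [X in _ <= X]mulnA; apply: leq_mul => //; apply: leq_mul.
Qed.

Lemma sum_bad : 16 * \sum_i #|[set f | ~~ good f i]| <= T * tot.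
Proof.
pose F1 i := \sum_(v in S0 i) #|[set f : {ffun V -> 'I_T} | (f v == i) && ~~ hits k f (A1 v i) i]|.
pose F2 i := \sum_(v in C2 i) #|[set f : {ffun V -> 'I_T} | ~~ hits k f (out v :&: G) i]|.
pose F3 i := \sum_(u in U i) \sum_j #|[set f : {ffun V -> 'I_T} | ~~ hits k f (A3 u (st i j)) i]|.
pose F4 i := \sum_(u in U i) \sum_j \sum_(w in A3 u (st i j) | ~~ E w (st i j))
  #|[set f : {ffun V -> 'I_T} | (f w == i) && ~~ hits k f (A4 w (st i j)) i]|.
have : \sum_i #|[set f | ~~ good f i]| <= \sum_i (F1 i + F2 i + F3 i + F4 i).
  apply: leq_sum => i _.
  pose X1 := \bigcup_(v in S0 i) [set f : {ffun V -> 'I_T} | (f v == i) && ~~ hits k f (A1 v i) i].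
  pose X2 := \bigcup_(v in C2 i) [set f : {ffun V -> 'I_T} | ~~ hits k f (out v :&: G) i].
  pose X3 := \bigcup_(u in U i) \bigcup_j [set f : {ffun V -> 'I_T} | ~~ hits k f (A3 u (st i j)) i].
  pose X4 := \bigcup_(u in U i) \bigcup_j \bigcup_(w in A3 u (st i j) | ~~ E w (st i j))
    [set f : {ffun V -> 'I_T} | (f w == i) && ~~ hits k f (A4 w (st i j)) i].
  have sub : [set f | ~~ good f i] \subset X1 :|: X2 :|: X3 :|: X4.
    apply/subsetP => f; rewrite inE /good !negb_and => /or3P [] /forallPn [].
    - move=> v; rewrite negb_imply => /andP [/andP [vS fv] nh]; rewrite !inE.
      by apply/orP; left; apply/orP; left; apply/orP; left; apply/bigcupP; exists v; rewrite // inE fv.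
    - move=> v; rewrite negb_imply => /andP [vC nh]; rewrite !inE.
      by apply/orP; left; apply/orP; left; apply/orP; right; apply/bigcupP; exists v; rewrite // inE.
    - move=> u; rewrite negb_imply => /andP [uU /forallPn [j]]; rewrite negb_and !inE => /orP [nh|].
        apply/orP; left; apply/orP; right; apply/bigcupP; exists u => //.
        by apply/bigcupP; exists j; rewrite // inE.
      move=> /forallPn [w]; rewrite !negb_imply => /andP [wA /andP [/andP [wx fw] nh]].
      apply/orP; right; apply/bigcupP; exists u => //; apply/bigcupP; exists j => //.
      by apply/bigcupP; exists w; rewrite ?wA ?inE ?fw.
  apply: (leq_trans (subset_leq_card sub)).
  apply: (leq_trans (leq_card_setU _ _).1); apply: leq_add.
    apply: (leq_trans (leq_card_setU _ _).1); apply: leq_add.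
      by apply: (leq_trans (leq_card_setU _ _).1); apply: leq_add; apply: card_bigcup_le.
    apply: (leq_trans (card_bigcup_le _ _)); apply: leq_sum => u _; exact: card_bigcup_le.
  apply: (leq_trans (card_bigcup_le _ _)); apply: leq_sum => u _.
  by apply: (leq_trans (card_bigcup_le _ _)); apply: leq_sum => j _; apply: card_bigcup_le.
have b1 : 64 * \sum_i F1 i <= T * tot := bad1.
have b2 : 64 * \sum_i F2 i <= T * tot := bad2.
have b3 : 64 * \sum_i F3 i <= T * tot := bad3.
have b4 : 64 * \sum_i F4 i <= T * tot := bad4.
rewrite !big_split /=; move: (\sum_i F1 i) (\sum_i F2 i) (\sum_i F3 i) (\sum_i F4 i) b1 b2 b3 b4.
by move: (\sum_i #|_|) (T * tot) => s x s1 s2 s3 s4; lia.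
Qed.

Lemma card_B4 : #|B4| <= 9 * D.
Proof.
have : T * #|B4| <= 8 * \sum_i #|S0 i|.
  apply: (@leq_trans (8 * \sum_i #|[set v | v \in S0 i]|)); last first.
    by rewrite leq_mul //; apply: leq_sum => i _; rewrite leq_eqVlt cardsE eqxx.
  rewrite sum_card_dep mulnC -sum_nat_const big_distrr /=.
  apply: (@leq_trans (\sum_(v in B4) 8 * #|[set i | v \in S0 i]|)).
    by apply: leq_sum => v; rewrite inE => /andP [].
  by rewrite [X in _ <= X](bigID (mem B4)) /= leq_addr.
have : 20 * \sum_i #|S0 i| <= T * (21 * D).
  by rewrite big_distrr /= -[T in X in _ <= X]card_ord -sum_nat_const; apply: leq_sum => i _; apply: card_S0.
move: (\sum_i _) => s; nia.
Qed.

(** In contrast to the colours, no vertex may fail here. This is affordable: the union over sets of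
    colours costs an exponent [T + k * T], at most 4kt, and only O(kt) + O(D) vertices are
    involved. *)
Lemma sum_few : 16 * \sum_(v in C4 :|: B4) #|[set f | few f v]| <= tot.
Proof.
have KD := D_large.
have split : \sum_(v in C4 :|: B4) #|[set f | few f v]| <=
    \sum_(v in C4) #|[set f | few f v]| + \sum_(v in B4) #|[set f | few f v]|.
  rewrite big_mkcond [X in X + _]big_mkcond [X in _ + X]big_mkcond -big_split /=.
  by apply: leq_sum => v _; rewrite in_setU; case: (v \in C4); case: (v \in B4); rewrite ?addn0 ?leq_addr.
have bound q v : 16 * (T + k * T + q) <= #|out v :&: G| -> #|[set f | few f v]| * 2 ^ q <= tot.
  move=> /(many_misses k T0); rewrite expnD mulnCA leq_pmul2l ?expn_gt0 //.
have C4b : 32 * \sum_(v in C4) #|[set f | few f v]| <= tot.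
  pose q := 30 * (k * t); have P0 : 0 < 2 ^ q by rewrite expn_gt0.
  rewrite -(leq_pmul2r P0) -mulnA big_distrl /=.
  apply: (@leq_trans (32 * (#|C4| * tot))).
    rewrite leq_mul // -sum_nat_const; apply: leq_sum => v; rewrite inE => /andP [_ vK].
    by apply: bound; have := card_out_unforced vK; rewrite /q; nia.
  have c4 : #|C4| <= 1200 * (k * t).
    by apply: leq_trans Cs_small; apply: subset_leq_card; apply/subsetP => v; rewrite inE => /andP [].
  have e4 := cubic_le_exp kt0; rewrite -/q in e4.
  have n3 : k * t <= k * t * (k * t) * (k * t) by move: (k * t) kt0 => n; nia.
  have H4 : 32 * #|C4| <= 2 ^ q.
    by move: n3 e4 c4; move: (k * t * (k * t) * (k * t)) (2 ^ q) #|C4| (k * t) => m x c n; lia.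
  by rewrite mulnA [X in _ <= X]mulnC; apply: leq_mul.
have B4b : 32 * \sum_(v in B4) #|[set f | few f v]| <= tot.
  (* A vertex of [B4] lies in some [S0 i], so more than D/2 of its out-neighbours are free, and
     [many_misses] applies with total exponent D/32. Again [q] grows with [D], to beat the 9D
     vertices of [B4]. *)
  pose q := D %/ 32 - (T + k * T); have P0 : 0 < 2 ^ q by rewrite expn_gt0.
  have TkT : T + k * T <= 4 * (k * t) by nia.
  have q30 : 30 * (k * t) <= q by rewrite /q; lia.
  have Dup : D < 32 * (T + k * T + q).+1 by rewrite /q in q30 *; lia.
  have Dlo : 32 * (T + k * T + q) <= D by rewrite /q in q30 *; lia.
  rewrite -(leq_pmul2r P0) -mulnA big_distrl /=.
  apply: (@leq_trans (32 * (#|B4| * tot))).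
    rewrite leq_mul // -sum_nat_const; apply: leq_sum => v; rewrite inE => /andP [vG vT].
    apply: bound; have /card_gt0P [i] : 0 < #|[set i | v \in S0 i]| by move: vT; lia.
    rewrite inE => vS0; have := card_out_free (S0_not_all vS0).
    have [_ vC] := free_notin vG; have := h_high hE vC; lia.
  have e4 : (30 * 1024) * q <= 2 ^ q by apply: linear_le_exp => //; lia.
  have H4 : 32 * #|B4| <= 2 ^ q.
    by move: card_B4 e4; move: (2 ^ q) #|B4| => x c; lia.
  by rewrite mulnA [X in _ <= X]mulnC; apply: leq_mul.
lia.
Qed.

End HalfCount.

(** * Colour classes are highly connected *)

Definition part (V : finType) T (L : 'I_T -> {set V}) (Cs : {set V}) f i :=
  L i :|: (free L Cs :&: cls f i).

(** * Reaching hubs and path starts inside a good colour class *)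

Section HalfReach.
Variables (V : finType) (T t k : nat).
Variables (P : 'I_T -> 'I_k -> seq V) (L : 'I_T -> {set V}) (Cs Mid : {set V}).
Variables (E : rel V) (U : 'I_T -> {set V}) (st : 'I_T -> 'I_k -> V) (K D b : nat).
Hypothesis k0 : 0 < k.
Hypothesis t0 : 0 < t.
Hypothesis TE : T = 2 * t.
Hypothesis hE : side P L Cs Mid E U st K D b.
Hypothesis P_L : forall i j v, v \in P i j -> v \in L i.
Hypothesis P_disj : forall i j j' v, v \in P i j -> v \in P i j' -> j = j'.
Hypothesis forced_mid : forall v, v \in forced L -> v \notin Cs -> v \in Mid.
Variable f : {ffun V -> 'I_T}.

Local Notation G := (free L Cs).
Local Notation good := (good L Cs E U st K D).
Local Notation part := (part L Cs f).

Lemma L_forced i v : v \in L i -> v \in forced L.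
Proof. by move=> vL; apply/bigcupP; exists i. Qed.

Lemma to_all_hub v i : to_all E U v -> k <= #|out E v :&: U i|.
Proof.
move=> all; rewrite (setIidPr _) ?(h_Usize hE); first by lia.
by apply/subsetP => u uU; rewrite inE; apply: all uU.
Qed.

Lemma midrich_many v i :
  (forall i j, exists2 q, q \in P i j & E v q && (q \in Mid)) ->
  k <= #|[set q in L i | E v q && (q \in Mid)]|.
Proof.
move=> rich; have [q qP qv] := fin_all_exists2 (rich i).
have inj : injective q by move=> j j' e; apply: (P_disj (qP j)); rewrite e; apply: qP.
rewrite -[k in k <= _]card_ord -(card_imset predT inj); apply: subset_leq_card.
by apply/subsetP => x /imsetP [j _ ->]; rewrite inE qv (P_L (qP j)).
Qed.

Section Removal.
Variables (i : 'I_T) (Z : {set V}).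
Hypothesis gi : good f i.
Hypothesis Zk : #|Z| < k.
Local Notation R := (restrict_rel E (part i :\: Z)).

Let step a c : a \in part i -> a \notin Z -> c \in part i -> c \notin Z -> E a c -> connect R a c.
Proof. by move=> ap aZ cp cZ Eac; apply: connect1; rewrite /restrict_rel !in_setD aZ cZ Eac ap cp. Qed.

Let reach_hub v := exists2 u, u \in U i :\: Z & connect R v u.

Let U_part u : u \in U i -> u \in part i.
Proof. by move=> uU; rewrite inE (subsetP (h_UL hE i)). Qed.

Let L_part v : v \in L i -> v \in part i.
Proof. by move=> uU; rewrite inE uU. Qed.

Let cls_part v : v \in G -> v \in cls f i -> v \in part i.
Proof. by move=> vG vc; rewrite in_setU in_setI vG vc orbT. Qed.

Let via_hub v : v \in part i -> v \notin Z -> k <= #|out E v :&: U i| -> reach_hub v.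
Proof.
move=> vp vZ vk; have [u] := card_gt_notin vk Zk; rewrite !inE => /andP [Evu uU] uZ.
by exists u; [rewrite in_setD uZ | apply: step => //; apply: U_part].
Qed.

Let via v A : v \in part i -> v \notin Z -> hits k f A i -> A \subset out E v :&: G ->
  (forall w, w \in A -> w \in cls f i -> w \notin Z -> reach_hub w) -> reach_hub v.
Proof.
move=> vp vZ vk /subsetP sub rA; have [w] := card_gt_notin vk Zk; rewrite in_setI => /andP [wA wc] wZ.
have := sub w wA; rewrite in_setI inE => /andP [Evw wG].
have [u uU wu] := rA w wA wc wZ; exists u => //; apply: connect_trans wu.
by apply: step => //; apply: cls_part.
Qed.

Let free_out_S0 w : w \in G -> w \notin S0 k L Cs E U i -> w \in cls f i -> w \notin Z -> reach_hub w.
Proof.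
move=> wG; rewrite inE wG /= -leqNgt => wk wc wZ; apply: via_hub wk => //.
exact: cls_part.
Qed.

Let free_out_S1 w : w \in G -> w \notin S1 k L Cs E U D i -> w \in cls f i -> w \notin Z -> reach_hub w.
Proof.
move=> wG wS1 wc wZ; case: (boolP (w \in S0 k L Cs E U i)) => [wS0|]; last by move=> ?; apply: free_out_S0.
have /and3P [/forallP/(_ w)] := gi; rewrite wS0 /=; move: (wc); rewrite inE => -> /= h _ _.
apply: (via _ wZ h); first exact: cls_part.
  by rewrite /A1 subDset subsetUr.
move=> x; rewrite /A1 (negbTE wS1) in_setD !in_setI => /andP [xS0 /andP [_ xG]] xc xZ.
exact: free_out_S0.
Qed.

Lemma free_reach w : w \in G -> w \in cls f i -> w \notin Z -> reach_hub w.
Proof.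
move=> wG wc wZ; case: (boolP (w \in S1 k L Cs E U D i)) => [wS1|]; last by move=> ?; apply: free_out_S1.
have wS0 : w \in S0 k L Cs E U i by move: wS1; rewrite inE => /andP [].
have /and3P [/forallP/(_ w)] := gi; rewrite wS0 /=; move: (wc); rewrite inE => -> /= h _ _.
apply: (via _ wZ h); first exact: cls_part.
  by rewrite /A1 subDset subsetUr.
move=> x; rewrite /A1 wS1 in_setD !in_setI => /andP [xS1 /andP [_ xG]] xc xZ.
exact: free_out_S1.
Qed.

Lemma mid_reach v : v \in L i -> v \in Mid -> v \notin Z -> reach_hub v.
Proof. by move=> vL vM vZ; apply: via_hub; rewrite ?L_part //; apply: to_all_hub; apply: h_mid hE _ vM. Qed.

Lemma part_reach v : v \in part i -> v \notin Z -> reach_hub v.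
Proof.
move=> vp vZ; move: (vp); rewrite in_setU => /orP [vL|]; last first.
  by rewrite in_setI => /andP [vG vc]; apply: free_reach.
case: (boolP (v \in Cs)) => [vC|vC]; last by apply: mid_reach => //; apply: forced_mid (L_forced vL) vC.
case: (h_care hE (L_forced vL) vC) => [rich|all|vK].
- have [q] := card_gt_notin (midrich_many i rich) Zk; rewrite inE => /and3P [qL Evq qM] qZ.
  have [u uU qu] := mid_reach qL qM qZ; exists u => //; apply: connect_trans qu.
  by apply: step; rewrite ?L_part.
- by apply: via_hub => //; apply: to_all_hub.
- have /and3P [_ /forallP/(_ v)] := gi; rewrite !inE vC vL vK /= => h _.
  apply: (via vp vZ h) => // w; rewrite in_setI => /andP [_ wG] wc wZ; exact: free_reach.
Qed.

(** Two intermediate vertices suffice: a surviving out-neighbour [w] of [u] in [A3], and, when [w]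
    does not beat the start, a surviving vertex of [A4] between them. *)
Lemma hub_start u j : u \in U i -> u \notin Z -> st i j \in part i -> st i j \notin Z ->
  connect R u (st i j).
Proof.
move=> uU uZ sp sZ; have /and3P [_ _ /forallP/(_ u)] := gi.
rewrite uU => /forallP/(_ j)/andP [h3 /forallP h4].
have [w] := card_gt_notin h3 Zk; rewrite in_setI => /andP [wA wc] wZ.
have := subsetP (trunc_sub _ _) w wA; rewrite in_setD in_setI inE => /andP [_ /andP [Euw wG]].
have wp : w \in part i by apply: cls_part.
rewrite inE in Euw; apply: connect_trans (step (U_part uU) uZ wp wZ Euw) _.
case: (boolP (E w (st i j))) => [Ews|Ews]; first exact: step.
have := h4 w; rewrite wA Ews; move: (wc); rewrite inE => -> /= h.
have [y] := card_gt_notin h Zk; rewrite in_setI => /andP [yA yc] yZ.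
move: yA; rewrite !in_setI !inE => /andP [/andP [Ewy Eys]]; rewrite -in_setU -in_setC => yG.
have yp : y \in part i by apply: cls_part.
exact: connect_trans (step wp wZ yp yZ Ewy) (step yp yZ sp sZ Eys).
Qed.

End Removal.

(** Randomness is needed only in [C4] and [B4]: a free vertex outside [B4] has [k] hubs as
    out-neighbours in all but fewer than T/8 colours, and the remaining vertices have [k] hub or
    path out-neighbours in every colour. *)
Lemma few_colours v :
  (forall v, v \in C4 L Cs E K :|: B4 k L Cs E U -> ~~ few k L Cs E f v) ->
  (v \in Cs -> cared P L Mid E U K v) ->
  8 * #|[set i | #|out E v :&: part i| < k]| < T.
Proof.
move=> nfew care.
have sub (I : {set 'I_T}) : [set i | #|out E v :&: part i| < k] \subset I -> 8 * #|I| < T ->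
    8 * #|[set i | #|out E v :&: part i| < k]| < T.
  by move=> /subset_leq_card le; apply: leq_ltn_trans; rewrite leq_mul2l.
have sub0 : (forall i, k <= #|out E v :&: part i|) -> 8 * #|[set i | #|out E v :&: part i| < k]| < T.
  move=> all; rewrite (_ : [set i | _] = set0) ?cards0; first by lia.
  by apply/setP => i; rewrite !inE ltnNge all.
have hub i : #|out E v :&: U i| <= #|out E v :&: part i|.
  by rewrite subset_leq_card ?setIS // subsetU // (h_UL hE).
have allc : to_all E U v -> 8 * #|[set i | #|out E v :&: part i| < k]| < T.
  by move=> all; apply: sub0 => i; apply: leq_trans (hub i); apply: to_all_hub.
have cls4 : v \in C4 L Cs E K :|: B4 k L Cs E U -> 8 * #|[set i | #|out E v :&: part i| < k]| < T.
  move=> /nfew; rewrite -ltnNge; apply: sub; apply/subsetP => i; rewrite !inE -ltnNge.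
  by apply: leq_ltn_trans; rewrite subset_leq_card // -setIA setIS // subsetUr.
case: (boolP (v \in Cs)) => [/[dup] vC /care [rich||vK]|vC].
- apply: sub0 => i; apply: leq_trans (midrich_many i rich) _; apply: subset_leq_card.
  by apply/subsetP => q; rewrite !inE => /and3P [-> -> _].
- exact: allc.
- by apply: cls4; rewrite !inE vC vK.
case: (boolP (v \in forced L)) => [vF|vF].
  by apply: allc; apply: h_mid hE _ (forced_mid vF vC).
have vG : v \in G by rewrite !inE negb_or vF vC.
case: (boolP (v \in B4 k L Cs E U)) => [vB|]; first by apply: cls4; rewrite in_setU vB orbT.
rewrite inE vG /= -ltnNge; apply: sub; apply/subsetP => i; rewrite inE => vi.
by rewrite inE inE vG; apply: leq_ltn_trans vi.
Qed.

End HalfReach.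

Lemma restrict_path (V : finType) (E : rel V) (S : {set V}) x p :
  path E x p -> all (mem S) (x :: p) -> path (restrict_rel E S) x p.
Proof.
elim: p x => //= y p IHp x /andP [Exy yp] /and3P [xS yS pS].
by rewrite /restrict_rel xS yS Exy /=; apply: IHp => //=; rewrite yS.
Qed.

Lemma partition_fibres (V : finType) t (c : V -> 'I_t) :
  (forall a, exists v, c v = a) ->
  partition [set [set v | c v == a] | a : 'I_t] [set: V] /\
  #|[set [set v | c v == a] | a : 'I_t]| = t.
Proof.
move=> sur; split; last first.
  rewrite card_imset ?card_ord // => a a' /setP eq.
  by have [v va] := sur a; have := eq v; rewrite !inE va eqxx => /esym /eqP.
apply/and3P; split.
- rewrite eqEsubset subsetT; apply/subsetP => v _; apply/bigcupP.
  by exists [set w | c w == c v]; [apply: imset_f | rewrite inE].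
- apply/trivIsetP => _ _ /imsetP [a _ ->] /imsetP [a' _ ->] aa'.
  rewrite -setI_eq0; apply/eqP/setP => v; rewrite !inE; apply/negbTE/negP => /andP [/eqP ca /eqP ca'].
  by rewrite -ca -ca' eqxx in aa'.
- apply/negP => /imsetP [a _] /setP eq; have [v va] := sur a.
  by have := eq v; rewrite !inE va eqxx.
Qed.

(** * Choice of the colouring and placement of the left-over vertices *)

Section Assembly.
Variables (V : finType) (T t k : nat).
Variables (P : 'I_T -> 'I_k -> seq V) (L : 'I_T -> {set V}) (Cs Mid : {set V}).
Variables (E : rel V) (U W : 'I_T -> {set V}) (st en : 'I_T -> 'I_k -> V) (K D D' b : nat).
Hypothesis k0 : 0 < k.
Hypothesis t0 : 0 < t.
Hypothesis TE : T = 2 * t.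
Hypothesis hE : side P L Cs Mid E U st K D b.
Hypothesis hE' : side P L Cs Mid (rv E) W en K D' b.
Hypothesis Cs_small : #|Cs| <= 1200 * (k * t).
Hypothesis b_small : b <= 100 * (k * t).
Hypothesis K_large : 100 * 1000 * (k * t) <= K.
Hypothesis L_disj : forall i i' v, v \in L i -> v \in L i' -> i = i'.
Hypothesis P_L : forall i j v, v \in P i j -> v \in L i.
Hypothesis P_disj : forall i j j' v, v \in P i j -> v \in P i j' -> j = j'.
Hypothesis forced_mid : forall v, v \in forced L -> v \notin Cs -> v \in Mid.
Hypothesis P_path : forall i j, exists p,
  [/\ P i j = st i j :: p, path E (st i j) p & last (st i j) p = en i j].
Hypothesis special : forall v, v \in Cs -> v \notin forced L ->
  [\/ cared P L Mid E U K v /\ cared P L Mid (rv E) W K v,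
      to_all (rv E) W v /\ K <= 4 * #|out E v :&: Mid| |
      to_all E U v /\ K <= 4 * #|out (rv E) v :&: Mid|].

Local Notation good1 := (good L Cs E U st K D).
Local Notation good2 := (good L Cs (rv E) W en K D').

Lemma part_kconnected f i : good1 f i -> good2 f i -> strongly_kconnected_on E k (part L Cs f i).
Proof.
move=> g1 g2; split.
  have sub : U i \subset part L Cs f i by rewrite subsetU // (h_UL hE).
  by apply: leq_trans (subset_leq_card sub); rewrite (h_Usize hE); lia.
move=> Z _ Zk u v; rewrite !in_setD => /andP [uZ up] /andP [vZ vp].
have [a] := part_reach k0 t0 TE hE P_L P_disj forced_mid g1 Zk up uZ; rewrite in_setD => /andP [aZ aU] ua.
have [c] := part_reach k0 t0 TE hE' P_L P_disj forced_mid g2 Zk vp vZ; rewrite in_setD => /andP [cZ cW].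
rewrite connect_restrict_rv => cv.
have [j jZ] : exists j, all (fun x => x \notin Z) (P i j).
  apply: NNPP => none.
  have hit j : exists2 q, q \in P i j & q \in Z.
    have /allPn [q qP] : ~~ all (fun x => x \notin Z) (P i j) by apply/negP => jZ; apply: none; exists j.
    by rewrite negbK => qZ; exists q.
  have [q qP qZ] := fin_all_exists2 hit.
  have inj : injective q by move=> j j' e; apply: (P_disj (qP j)); rewrite e; apply: qP.
  have : k <= #|Z|.
    rewrite -[k in k <= _]card_ord -(card_imset predT inj); apply: subset_leq_card.
    by apply/subsetP => x /imsetP [j _ ->].
  by rewrite leqNgt Zk.
have [p [Pij pth lst]] := P_path i j.
have inR x : x \in P i j -> x \in part L Cs f i :\: Z.
  by move=> xP; rewrite in_setD (allP jZ) //= in_setU (P_L xP).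
have sR : st i j \in part L Cs f i :\: Z by apply: inR; rewrite Pij mem_head.
have eR : en i j \in part L Cs f i :\: Z by apply: inR; rewrite Pij -lst mem_last.
have se : connect (restrict_rel E (part L Cs f i :\: Z)) (st i j) (en i j).
  apply/connectP; exists p => //; apply: restrict_path pth _.
  by rewrite -Pij; apply/allP => x; apply: inR.
move: sR eR; rewrite !in_setD => /andP [sZ sp] /andP [eZ ep].
apply: connect_trans ua _; apply: connect_trans (hub_start hE g1 Zk aU aZ sp sZ) _.
apply: connect_trans se _; apply: connect_trans cv.
by rewrite -connect_restrict_rv; exact: (hub_start hE' g2 Zk cW cZ ep eZ).
Qed.

Lemma good_colouring : exists f : {ffun V -> 'I_T},
  [/\ t <= #|[set i | good1 f i && good2 f i]|,
      forall v, v \in C4 L Cs E K :|: B4 k L Cs E U -> ~~ few k L Cs E f v &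
      forall v, v \in C4 L Cs (rv E) K :|: B4 k L Cs (rv E) W -> ~~ few k L Cs (rv E) f v].
Proof.
have T0 : 0 < T by lia.
pose N1 (f : {ffun V -> 'I_T}) := #|[set i | ~~ good1 f i]|.
pose N2 (f : {ffun V -> 'I_T}) := #|[set i | ~~ good2 f i]|.
pose F1 f := #|[set v in C4 L Cs E K :|: B4 k L Cs E U | few k L Cs E f v]|.
pose F2 f := #|[set v in C4 L Cs (rv E) K :|: B4 k L Cs (rv E) W | few k L Cs (rv E) f v]|.
pose tot := T ^ #|V|.
have b1 : 16 * \sum_f N1 f <= T * tot.
  rewrite /N1 (sum_card_dep (fun f i => ~~ good1 f i)).
  exact: (sum_bad k0 t0 TE hE Cs_small b_small K_large L_disj).
have b2 : 16 * \sum_f N2 f <= T * tot.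
  rewrite /N2 (sum_card_dep (fun f i => ~~ good2 f i)).
  exact: (sum_bad k0 t0 TE hE' Cs_small b_small K_large L_disj).
have b3 : 16 * \sum_f F1 f <= tot.
  rewrite /F1 (sum_card_dep (fun f v => (v \in _) && _)).
  apply: leq_trans (sum_few k0 t0 TE hE Cs_small b_small K_large); rewrite leq_mul // [X in _ <= X]big_mkcond.
  apply: leq_sum => v _; case: ifP => vC; first by rewrite leq_eqVlt eqxx.
  by rewrite leqn0 cards_eq0; apply/eqP/setP => f; rewrite !inE.
have b4 : 16 * \sum_f F2 f <= tot.
  rewrite /F2 (sum_card_dep (fun f v => (v \in _) && _)).
  apply: leq_trans (sum_few k0 t0 TE hE' Cs_small b_small K_large); rewrite leq_mul // [X in _ <= X]big_mkcond.
  apply: leq_sum => v _; case: ifP => vC; first by rewrite leq_eqVlt eqxx.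
  by rewrite leqn0 cards_eq0; apply/eqP/setP => f; rewrite !inE.
(* On average [N1 + N2] is at most T/8 and [F1 + F2] at most 1/8. The weight [T] makes one averaging
   argument do both jobs: at most T/4 failing colours and no failing vertex. *)
have [f Hf] : exists f, 4 * (N1 f + N2 f + T * (F1 f + F2 f)) <= T.
  apply: NNPP => none.
  have : \sum_(f : {ffun V -> 'I_T}) T.+1 <= \sum_f 4 * (N1 f + N2 f + T * (F1 f + F2 f)).
    by apply: leq_sum => f _; rewrite ltnNge; apply/negP => le; apply: none; exists f.
  rewrite sum_nat_const card_ffun_ord -/tot -big_distrr /= !big_split /= -big_distrr /= big_split /=.
  move: (\sum_f N1 f) (\sum_f N2 f) (\sum_f F1 f) (\sum_f F2 f) b1 b2 b3 b4 => n1 n2 f1 f2.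
  have : 0 < tot by rewrite expn_gt0 T0.
  by move: tot => x; nia.
have F0 : F1 f = 0 /\ F2 f = 0.
  by move: (F1 f) (F2 f) Hf => x y; nia.
exists f; split.
- have : N1 f + N2 f <= t by move: F0 Hf => [-> ->]; rewrite muln0; lia.
  have : #|~: [set i | good1 f i && good2 f i]| <= N1 f + N2 f.
    have sub : ~: [set i | good1 f i && good2 f i] \subset [set i | ~~ good1 f i] :|: [set i | ~~ good2 f i].
      by apply/subsetP => i; rewrite !inE negb_and.
    by have := card_le_setU sub.
  by have := cardsC [set i | good1 f i && good2 f i]; rewrite card_ord; lia.
- move=> v vC; apply/negP => vf; have := cards0_eq F0.1 => /setP /(_ v).
  by rewrite in_set0 inE vC vf.
- move=> v vC; apply/negP => vf; have := cards0_eq F0.2 => /setP /(_ v).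
  by rewrite in_set0 inE vC vf.
Qed.

Theorem assembly : exists Q : {set {set V}},
  [/\ partition Q [set: V], #|Q| = t & forall Vi, Vi \in Q -> strongly_kconnected_on E k Vi].
Proof.
have [f [tJ few1 few2]] := good_colouring.
have [h hinj hgood] : exists2 h : 'I_t -> 'I_T, injective h &
    forall a, h a \in [set i | good1 f i && good2 f i] by apply: embed_into; rewrite card_ord.
pose B a := part L Cs f (h a).
have Bk a : strongly_kconnected_on E k (B a).
  by have := hgood a; rewrite inE => /andP [g1 g2]; apply: part_kconnected.
have part_disj i i' v : v \in part L Cs f i -> v \in part L Cs f i' -> i = i'.
  rewrite !inE => /orP [vL|/andP [vF /eqP <-]] /orP [vL'|/andP [vF' /eqP <-]] //.
  - exact: L_disj vL vL'.
  - by move: vF'; rewrite (L_forced vL).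
  - by move: vF; rewrite (L_forced vL').
have B_disj a a' v : v \in B a -> v \in B a' -> a = a' by move=> va va'; apply: hinj; apply: part_disj va va'.
pose a0 : 'I_t := Ordinal t0.
(* Vertices of [Mid] left without a kept class are joined to all hubs in both directions, so a
   single class can absorb them. Afterwards the classes cover [Mid], which [heavy] relies on. *)
pose drop := [set v in Mid | [forall a, v \notin B a]].
pose B' a := if a == a0 then B a :|: drop else B a.
have BB' a : B a \subset B' a by rewrite /B'; case: ifP => _ //; apply: subsetUl.
have B'k a : strongly_kconnected_on E k (B' a).
  rewrite /B'; case: ifP => // _; apply: kconn_add => // v; rewrite inE => /andP [vM _]; split.
    have := to_all_hub k0 t0 TE hE (h a) (h_mid hE vM); move/leq_trans; apply.
    by rewrite subset_leq_card // setIS // subsetU // (h_UL hE).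
  have := to_all_hub k0 t0 TE hE' (h a) (h_mid hE' vM); move/leq_trans; apply.
  by rewrite subset_leq_card // setIS // subsetU // (h_UL hE').
have B'_disj a a' v : v \in B' a -> v \in B' a' -> a = a'.
  have H x : v \in B' x -> v \in B x \/ x = a0 /\ v \in drop.
    rewrite /B'; case: eqP => [->|_]; last by left.
    by rewrite in_setU => /orP [|vd]; [left|right].
  move=> v1 v2; case: (H _ v1) => [va | [ea vd]]; case: (H _ v2) => [va' | [ea' vd']].
  - exact: B_disj va va'.
  - by move: vd'; rewrite inE => /andP [_ /forallP/(_ a)]; rewrite va.
  - by move: vd; rewrite inE => /andP [_ /forallP/(_ a')]; rewrite va'.
  - by rewrite ea ea'.
have Mid_cov v : v \in Mid -> exists a, v \in B' a.
  move=> vM; case: (boolP [forall a, v \notin B a]) => [vd|/forallPn [a]].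
    by exists a0; rewrite /B' eqxx in_setU; apply/orP; right; rewrite inE vM.
  by rewrite negbK => va; exists a; apply: (subsetP (BB' a)).
(* Pigeonhole: K/4 is far larger than kt. The class cannot be prescribed, so this serves vertices
   whose other direction is fine in every class. *)
have heavy (X : {set V}) : K <= 4 * #|X :&: Mid| -> exists a, k <= #|X :&: B' a|.
  move=> XK; apply: NNPP => none.
  have sub : X :&: Mid \subset \bigcup_(a : 'I_t) (X :&: B' a).
    apply/subsetP => v; rewrite in_setI => /andP [vX /Mid_cov [a va]].
    by apply/bigcupP; exists a; rewrite // in_setI vX.
  have : \sum_(a : 'I_t) #|X :&: B' a| <= \sum_(a : 'I_t) k.
    apply: leq_sum => a _; apply: ltnW; rewrite ltnNge; apply/negP => le; apply: none; by exists a.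
  rewrite sum_nat_const card_ord; have := leq_trans (subset_leq_card sub) (card_bigcup_le _ _).
  by move: #|X :&: Mid| XK (\sum_(a : 'I_t) _) => x; move: K_large; nia.
have all_in (F : rel V) (Y : 'I_T -> {set V}) s d v a : side P L Cs Mid F Y s K d b -> to_all F Y v ->
    k <= #|out F v :&: B' a|.
  move=> hF allv; apply: leq_trans (to_all_hub k0 t0 TE hF (h a) allv) _.
  by rewrite subset_leq_card // setIS // (subset_trans _ (BB' a)) // subsetU // (h_UL hF).
have both v : (v \in Cs -> cared P L Mid E U K v) -> (v \in Cs -> cared P L Mid (rv E) W K v) ->
    exists a, k <= #|out E v :&: B' a| /\ k <= #|out (rv E) v :&: B' a|.
  move=> c1 c2; apply: NNPP => none.
  have s1 := few_colours k0 t0 TE hE P_L P_disj forced_mid few1 c1.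
  have s2 := few_colours k0 t0 TE hE' P_L P_disj forced_mid few2 c2.
  (* Each direction spoils fewer than T/8 colours, together fewer than t/2, while [t] classes are
     kept. *)
  have : #|[set h a | a : 'I_t]| <= #|[set i | #|out E v :&: part L Cs f i| < k]|
      + #|[set i | #|out (rv E) v :&: part L Cs f i| < k]|.
    apply: card_le_setU; apply/subsetP => _ /imsetP [a _ ->]; rewrite !inE !ltnNge -negb_and.
    apply/negP => /andP [le1 le2]; apply: none; exists a; split.
      by apply: leq_trans le1 _; rewrite subset_leq_card // setIS // BB'.
    by apply: leq_trans le2 _; rewrite subset_leq_card // setIS // BB'.
  by rewrite card_imset // card_ord; lia.
have pick v : exists a, (v \in B' a) \/
    (forall a', v \notin B' a') /\ k <= #|out E v :&: B' a| /\ k <= #|out (rv E) v :&: B' a|.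
  case: (classic (exists a, v \in B' a)) => [[a va]|nB]; first by exists a; left.
  have nB' a' : v \notin B' a' by apply/negP => va; apply: nB; exists a'.
  suff [a Ha] : exists a, k <= #|out E v :&: B' a| /\ k <= #|out (rv E) v :&: B' a| by exists a; right.
  case: (boolP (v \in Cs)) => [vC|vC]; last by apply: both; rewrite (negbTE vC).
  case: (boolP (v \in forced L)) => [vF|vF].
    by apply: both => _; [exact: (h_care hE vF vC) | exact: (h_care hE' vF vC)].
  case: (special vC vF) => [[c1 c2]|[allW /heavy [a ka]]|[allU /heavy [a ka]]]; first exact: both.
    by exists a; split; rewrite // (all_in _ _ _ _ _ _ hE').
  by exists a; split; rewrite // (all_in _ _ _ _ _ _ hE).
have [c Hc] := fin_all_exists pick.
have cB a v : v \in B' a -> c v = a.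
  by move=> va; case: (Hc v) => [vc|[nB _]]; [apply: B'_disj vc va | have := nB a; rewrite va].
have fib a : [set v | c v == a] = B' a :|: [set v | (c v == a) && (v \notin B' a)].
  by apply/setP => v; rewrite !inE; case: (boolP (v \in B' a)) => [/cB -> | _]; rewrite ?eqxx ?andbT.
have [pQ cQ] : partition [set [set v | c v == a] | a : 'I_t] [set: V] /\
    #|[set [set v | c v == a] | a : 'I_t]| = t.
  apply: partition_fibres => a; have [k1 _] := B'k a.
  have /card_gt0P [v va] : 0 < #|B' a| by apply: leq_trans k1.
  by exists v; apply: cB.
exists [set [set v | c v == a] | a : 'I_t]; split=> // _ /imsetP [a _ ->].
rewrite fib; apply: kconn_add => // v; rewrite inE => /andP [/eqP ca vB].
by case: (Hc v) => [|[_]]; rewrite ca // (negbTE vB).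
Qed.

End Assembly.

(** * Menger's theorem and minimal linkages *)

Section Linkages.
Variable V : finType.
Implicit Types (e : rel V) (A B S : {set V}) (s p : seq V).

(** A one-vertex list in [A :&: B] counts as a path, as Menger's theorem requires. Inner vertices
    may lie in [A] or [B]; minimality excludes this later where it matters. *)
Definition lpath e A B s :=
  if s is x :: p then [&& x \in A, last x p \in B & path e x p] else false.

Definition linkage e A B n (g : 'I_n -> seq V) :=
  (forall i, lpath e A B (g i) && uniq (g i)) /\ (forall i j v, v \in g i -> v \in g j -> i = j).

Lemma lpath_prefix e A B B' s1 x s2 :
  lpath e A B (s1 ++ x :: s2) -> x \in B' -> lpath e A B' (rcons s1 x).
Proof.
case: s1 => [|u s1] /=; first by case/and3P => -> _ _ ->.
by case/and3P => -> _; rewrite cat_path rcons_path last_rcons /= => /and3P [-> -> _] ->.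
Qed.

Lemma lpath_suffix e A A' B s1 x s2 :
  lpath e A B (s1 ++ x :: s2) -> x \in A' -> lpath e A' B (x :: s2).
Proof.
case: s1 => [|u s1] /=; first by case/and3P => _ -> -> ->.
by case/and3P => _; rewrite last_cat cat_path /= => -> /and3P [_ _ ->] ->.
Qed.

Lemma lpath_glue e A A' B B' s1 x s2 :
  lpath e A B' (rcons s1 x) -> lpath e A' B (x :: s2) -> lpath e A B (rcons s1 x ++ s2).
Proof.
case: s1 => [|u s1] /=; first by case/and3P => -> _ _ /and3P [_ -> ->].
case/and3P => -> _ pth /and3P [_ lst pth2].
by rewrite cat_path last_cat last_rcons lst pth pth2.
Qed.

Lemma lpath_glue_edge e A A' B B' s1 x y s2 : e x y ->
  lpath e A B' (rcons s1 x) -> lpath e A' B (y :: s2) -> lpath e A B (rcons s1 x ++ y :: s2).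
Proof.
move=> exy; case: s1 => [|u s1] /=; first by case/and3P => -> _ _ /and3P [_ -> ->]; rewrite exy.
case/and3P => -> _ pth /and3P [_ lst pth2].
by rewrite cat_path last_cat last_rcons /= lst pth exy pth2.
Qed.

Lemma lpath_sub e e' A B s : subrel e e' -> lpath e A B s -> lpath e' A B s.
Proof. by move=> sub; case: s => //= x p /and3P [-> -> /(sub_path sub) ->]. Qed.

Lemma lpath_rev e A B s : lpath (rv e) B A (rev s) = lpath e A B s.
Proof.
case: s => // x p; rewrite [in LHS]lastI rev_rcons /=.
have -> : last (last x p) (rev (belast x p)) = x by case: p => //= y p; rewrite rev_cons last_rcons.
have -> : path (rv e) (last x p) (rev (belast x p)) = path e x p.
  by rewrite rev_path; apply: eq_path.
by rewrite andbCA.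
Qed.

Lemma split_at v s : v \in s -> exists s1 s2, s = s1 ++ v :: s2.
Proof. by case/splitPr => s1 s2; exists s1, s2. Qed.

Lemma first_hit (P : pred V) s : has P s ->
  exists s1 x s2, [/\ s = s1 ++ x :: s2, P x & ~~ has P s1].
Proof.
elim: s => //= y s IHs; case: (boolP (P y)) => [Py _|nPy /= /IHs [s1 [x [s2 [-> Px nP]]]]].
  by exists [::], y, s.
by exists (y :: s1), x, s2; rewrite /= negb_or nPy nP.
Qed.

Lemma last_hit (P : pred V) s : has P s ->
  exists s1 x s2, [/\ s = s1 ++ x :: s2, P x & ~~ has P s2].
Proof.
rewrite -has_rev => /first_hit [s1 [x [s2 [eq Px nP]]]].
exists (rev s2), x, (rev s1); rewrite has_rev; split=> //.
by rewrite -[s]revK eq rev_cat rev_cons cat_rcons.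
Qed.

Definition sep e A B S := forall s, lpath e A B s -> has (mem S) s.

Lemma lost_edge e x y u p : path e u p ->
  ~~ path (fun a b => e a b && ((a, b) != (x, y))) u p -> (x \in belast u p) && (y \in p).
Proof.
elim: p u => //= v p IHp u /andP [euv pth]; rewrite euv /= negb_and => /orP [].
  by rewrite negbK xpair_eqE => /andP [/eqP -> /eqP ->]; rewrite !mem_head.
by move=> /(IHp _ pth) /andP [xb yp]; rewrite !in_cons xb yp !orbT.
Qed.

Section Gluing.
Variables (e : rel V) (A B S : {set V}) (x y : V) (n : nat).
Let e' := fun a b => e a b && ((a, b) != (x, y)).
Hypothesis exy : e x y.
Hypothesis xS : x \notin S.
Hypothesis yS : y \notin S.
Hypothesis cS : n = #|S|.+1.
Hypothesis sepS : sep e' A B S.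
Variables (g1 g2 : 'I_n -> seq V).
Hypothesis L1 : linkage e' A (x |: S) g1.
Hypothesis L2 : linkage e' (y |: S) B g2.

Lemma linkage_ends i : exists2 p, p \in x |: S & exists a, g1 i = rcons a p.
Proof.
have /andP [] := L1.1 i; case: (g1 i) => // u s /= /and3P [_ lst _] _.
by exists (last u s) => //; exists (belast u s); rewrite lastI.
Qed.

Lemma linkage_starts i : exists2 q, q \in y |: S & exists b, g2 i = q :: b.
Proof.
have /andP [] := L2.1 i; case: (g2 i) => // u s /= /and3P [uA _ _] _.
by exists u => //; exists s.
Qed.

(** By cardinality the ends of [g1] are exactly [x |: S] and the starts of [g2] exactly [y |: S].
    They are joined at equal vertices of [S], and once across the edge from [x] to [y]. Paths of the
    two families meet nowhere else: a meeting point yields a path avoiding that edge, which must hit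
    [S], and [S] occurs only at the ends. *)
Lemma glue : exists g : 'I_n -> seq V, linkage e A B g.
Proof.
have [p pP pE] := fin_all_exists2 linkage_ends; have [a aE] := fin_all_exists pE => {pE}.
have [q qQ qE] := fin_all_exists2 linkage_starts; have [b bE] := fin_all_exists qE => {qE}.
have U1 i : uniq (g1 i) by have /andP [] := L1.1 i.
have U2 i : uniq (g2 i) by have /andP [] := L2.1 i.
have p_in i : p i \in g1 i by rewrite aE mem_rcons mem_head.
have q_in i : q i \in g2 i by rewrite bE mem_head.
have p_inj : injective p by move=> i j eq; apply: (L1.2 i j (p i)); rewrite // eq.
have q_inj : injective q by move=> i j eq; apply: (L2.2 i j (q i)); rewrite // eq.
have cP : #|x |: S| = n by rewrite cardsU1 xS cS.
have cQ : #|y |: S| = n by rewrite cardsU1 yS cS.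
have p_sur v : v \in x |: S -> exists i, p i = v.
  move=> vP; have : [set p i | i : 'I_n] = x |: S.
    apply/eqP; rewrite eqEcard card_imset // cP card_ord leqnn andbT.
    by apply/subsetP => w /imsetP [i _ ->].
  by move=> /setP /(_ v); rewrite vP => /imsetP [i _ ->]; exists i.
have q_sur v : v \in y |: S -> exists i, q i = v.
  move=> vP; have : [set q i | i : 'I_n] = y |: S.
    apply/eqP; rewrite eqEcard card_imset // cQ card_ord leqnn andbT.
    by apply/subsetP => w /imsetP [i _ ->].
  by move=> /setP /(_ v); rewrite vP => /imsetP [i _ ->]; exists i.
have p_only i v : v \in g1 i -> v \in x |: S -> v = p i.
  by move=> vi /p_sur [j ev]; rewrite -ev (L1.2 i j v) // -ev.
have q_only i v : v \in g2 i -> v \in y |: S -> v = q i.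
  by move=> vi /q_sur [j ev]; rewrite -ev (L2.2 i j v) // -ev.
have cross i j v : v \in g1 i -> v \in g2 j -> [/\ v = p i, v = q j & v \in S].
  move=> vi vj; have [s1 [s2 eq1]] := split_at vi; have [r1 [r2 eq2]] := split_at vj.
  have /andP [l1 _] := L1.1 i; have /andP [l2 _] := L2.1 j; rewrite eq1 in l1; rewrite eq2 in l2.
  have glued : lpath e' A B (rcons s1 v ++ r2).
    apply: (@lpath_glue _ _ setT _ setT); first exact: lpath_prefix l1 (in_setT _).
    exact: lpath_suffix l2 (in_setT _).
  have /hasP [z zin] := sepS glued; rewrite -[mem S z]/(z \in S) => zS.
  have vz : v = z.
    move: zin; rewrite mem_cat mem_rcons in_cons => /orP [/orP [/eqP -> //|zs1]|zr2].
      have zp : z = p i by apply: p_only; rewrite ?eq1 ?mem_cat ?zs1 // in_setU zS orbT.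
      have := U1 i; rewrite eq1 cat_uniq => /and3P [_ /hasPn H _].
      have : p i \in v :: s2.
        have : last v (s1 ++ v :: s2) = last v (rcons (a i) (p i)) by rewrite -eq1 -aE.
        by rewrite last_cat last_rcons /= => <-; apply: mem_last.
      by move=> /H; rewrite -zp /= zs1.
    have zq : z = q j by apply: q_only; rewrite ?eq2 ?mem_cat ?in_cons ?zr2 ?orbT // in_setU zS orbT.
    have := U2 j; rewrite eq2; have := bE j; rewrite eq2 -zq.
    case: r1 {l2 eq2} => [|w r1] /=; first by case=> -> _.
    by case=> -> _; rewrite mem_cat in_cons zr2 !orbT.
  split; last by rewrite vz.
    by apply: p_only => //; rewrite vz in_setU zS orbT.
  by apply: q_only => //; rewrite vz in_setU zS orbT.
have [sg sgE] : exists sg : 'I_n -> 'I_n, forall i, q (sg i) = if p i == x then y else p i.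
  apply: (@fin_all_exists _ _ (fun i j => q j = if p i == x then y else p i)) => i; apply: q_sur; case: eqP => [_|/eqP npx]; first by rewrite setU11.
  by have := pP i; rewrite !inE (negbTE npx) => /= ->; rewrite orbT.
have pS i : p i != x -> p i \in S by move=> npx; have := pP i; rewrite !inE (negbTE npx).
have sg_inj : injective sg.
  move=> i j eq; apply: p_inj; have := sgE j; rewrite -eq sgE.
  case: eqP => [->|/eqP ni]; case: eqP => [-> //|/eqP nj] ee //.
    by have := pS j nj; rewrite -ee (negbTE yS).
  by have := pS i ni; rewrite ee (negbTE yS).
(* Across the edge all of [g2] is appended; at a common vertex of [S] its first vertex is dropped to
   avoid a repetition. *)
pose tl i := if p i == x then g2 (sg i) else b (sg i).
have tl_sub i v : v \in tl i -> v \in g2 (sg i).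
  by rewrite /tl; case: ifP => // _ vb; rewrite bE in_cons vb orbT.
have tl_g1 i j v : v \in g1 i -> v \in tl j -> False.
  move=> vi vj; have [_ vq vS] := cross _ _ _ vi (tl_sub _ _ vj); move: vj; rewrite /tl.
  case: eqP => [px _|_ vb]; first by move: vS; rewrite vq sgE px eqxx (negbTE yS).
  by have := U2 (sg j); rewrite bE /= -vq vb.
exists (fun i => g1 i ++ tl i); split=> [i|i j v].
  apply/andP; split; last first.
    rewrite cat_uniq U1 /=; apply/andP; split.
      by apply/hasPn => v vt; apply/negP => vi; apply: tl_g1 vi vt.
    by rewrite /tl; case: ifP => _; [apply: U2 | have := U2 (sg i); rewrite bE => /andP []].
  have /andP [l1 _] := L1.1 i; have /andP [l2 _] := L2.1 (sg i).
  have sub : subrel e' e by move=> c d /andP [].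
  move: l1 l2 => /(lpath_sub sub) l1 /(lpath_sub sub) l2; rewrite aE in l1 *.
  rewrite /tl bE in l2 *; have := sgE i; case: eqP => [px|_] qs.
    by rewrite qs px in l1 l2 *; apply: lpath_glue_edge exy l1 l2.
  by rewrite qs in l2; apply: lpath_glue l1 l2.
rewrite !mem_cat => /orP [vi|vi] /orP [vj|vj].
- exact: L1.2 vi vj.
- by case: (tl_g1 _ _ _ vi vj).
- by case: (tl_g1 _ _ _ vj vi).
- by apply: sg_inj; apply: (L2.2 _ _ v); apply: tl_sub.
Qed.

End Gluing.

(* Göring's proof of Menger's theorem: induction on the number of edges. *)
Theorem menger e A B n :
  (forall S, sep e A B S -> n <= #|S|) -> exists g : 'I_n -> seq V, linkage e A B g.
Proof.
have [m] := ubnP #|[set p : V * V | e p.1 p.2]|.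
elim: m e A B => // m IHm e A B em large.
case: (classic (exists x y, e x y)) => [[x [y exy]]|noedge]; last first.
  have nAB : n <= #|A :&: B|.
    apply: large => -[|u [|v s]] //=; first by case/and3P => uA uB _; rewrite inE uA uB.
    by case/and4P => _ _ euv; case: noedge; exists u, v.
  have [h h_inj hAB] : exists2 h : 'I_n -> V, injective h & forall i, h i \in A :&: B.
    by apply: embed_into; rewrite card_ord.
  exists (fun i => [:: h i]); split=> [i|i j v].
    by have := hAB i; rewrite inE /= => /andP [-> ->].
  by rewrite !inE => /eqP -> /eqP /h_inj.
pose e' := fun a b => e a b && ((a, b) != (x, y)).
have em' : #|[set p : V * V | e' p.1 p.2]| < m.
  apply: leq_trans (_ : #|[set p : V * V | e p.1 p.2]| <= m); last by rewrite -ltnS.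
  apply: proper_card; apply/properP; split.
    by apply/subsetP => p; rewrite !inE => /andP [].
  by exists (x, y); rewrite !inE /= ?exy // /e' eqxx andbF.
have sub : subrel e' e by move=> c d /andP [].
case: (classic (forall S, sep e' A B S -> n <= #|S|)) => [large'|].
  have [g [gp gd]] := IHm _ _ _ em' large'; exists g; split=> // i.
  by have /andP [/(lpath_sub sub) -> ->] := gp i.
move=> /not_all_ex_not [S nS]; have [sepS /negP] := imply_to_and _ _ nS.
rewrite -ltnNge => Sn {nS}.
have lost s : lpath e A B s -> lpath e' A B s \/ x \in s /\ y \in s.
  case: s => //= u p /and3P [-> -> pth] /=; case: (boolP (path e' u p)) => [|np]; first by left.
  have /andP [xb yp] := lost_edge pth np; right.
  by rewrite (mem_belast xb) in_cons yp orbT.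
(* A path that avoids [S] has to use the removed edge, so adding either end of it gives a separator.
   Hence [x] and [y] are not in [S] and [n = #|S| + 1]. *)
have sepP z : z = x \/ z = y -> sep e A B (z |: S).
  move=> zxy s ls; case: (lost s ls) => [/sepS /hasP [v vs vS]|[xs ys]].
    by apply/hasP; exists v => //; apply: (subsetP (subsetUr _ _)).
  by apply/hasP; exists z; [case: zxy => -> | apply: setU11].
have xP := sepP x (or_introl erefl); have yP := sepP y (or_intror erefl).
have := large _ xP; have := large _ yP; rewrite !cardsU1.
case: (boolP (y \in S)) => yS /=; first by rewrite leqNgt Sn.
case: (boolP (x \in S)) => xS /= _; first by rewrite leqNgt Sn.
rewrite add1n => nS; have cS : n = #|S|.+1 by apply/eqP; rewrite eqn_leq nS Sn.
have [g1 L1] : exists g : 'I_n -> seq V, linkage e' A (x |: S) g.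
  apply: IHm => // S1 sep1; apply: large => s ls.
  have [s1 [z [s2 [es zP ns1]]]] := first_hit (xP _ ls); rewrite es in ls *.
  have pre := lpath_prefix ls zP.
  (* Up to its first vertex in [x |: S] the path cannot use the edge from [x] to [y], as [x] would
     occur before the last vertex. *)
  have pre' : lpath e' A (x |: S) (rcons s1 z).
    move: pre; case: s1 ns1 {es ls} => [|u s1] ns1; first by [].
    rewrite /= => /and3P [-> -> pth] /=; apply: contraT => np.
    have /andP [] := lost_edge pth np; rewrite belast_rcons => xs1 _.
    by case/hasPn/(_ _ xs1)/negP: ns1; apply: setU11.
  have := sep1 _ pre'; rewrite has_rcons has_cat /= => /orP [->|->]; by rewrite ?orbT.
have [g2 L2] : exists g : 'I_n -> seq V, linkage e' (y |: S) B g.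
  apply: IHm => // S1 sep1; apply: large => s ls.
  have [s1 [z [s2 [es zP ns2]]]] := last_hit (yP _ ls); rewrite es in ls *.
  have suf := lpath_suffix ls zP.
  have suf' : lpath e' (y |: S) B (z :: s2).
    move: suf; rewrite /= => /and3P [-> -> pth] /=; apply: contraT => np.
    have /andP [_ ys2] := lost_edge pth np.
    by case/hasPn/(_ _ ys2)/negP: ns2; apply: setU11.
  by have := sep1 _ suf'; rewrite has_cat => ->; rewrite orbT.
exact: (glue exy xS yS cS sepS L1 L2).
Qed.

Definition total n (g : 'I_n -> seq V) := \sum_i size (g i).
Definition minimal e A B n (g : 'I_n -> seq V) :=
  linkage e A B g /\ forall g' : 'I_n -> seq V, linkage e A B g' -> total g <= total g'.

Lemma minimal_exists e A B n (g : 'I_n -> seq V) : linkage e A B g ->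
  exists g' : 'I_n -> seq V, minimal e A B g'.
Proof.
move=> Lg; have [m [[g' [Lg' gm]] min]] := @ex_min_nat
  (fun m => exists g' : 'I_n -> seq V, linkage e A B g' /\ total g' = m) (ex_intro _ _ (ex_intro _ _ (conj Lg erefl))).
by exists g'; split=> // g2 Lg2; rewrite gm; apply: min; exists g2.
Qed.

Lemma exchange e A B n (g : 'I_n -> seq V) i s : minimal e A B g ->
  lpath e A B s -> uniq s -> (forall v, v \in s -> v \in g i \/ forall j, v \notin g j) ->
  size (g i) <= size s.
Proof.
move=> [[gp gd] min] ls us sP.
pose g' j := if j == i then s else g j.
have Lg' : linkage e A B g'.
  split=> [j|j j' v]; first by rewrite /g'; case: ifP => _; rewrite ?ls ?gp.
  rewrite /g'; case: eqP => [->|ji]; case: eqP => [-> //|j'i] //.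
  - by move=> /sP [vi vj'|nv]; [apply: gd vi vj' | move=> vj'; have := nv j'; rewrite vj'].
  - by move=> vj /sP [vi|nv]; [apply: gd vj vi | have := nv j; rewrite vj].
  - exact: gd.
have := min _ Lg'; rewrite /total (bigD1 i) //= [X in _ <= X](bigD1 i) //= /g' eqxx.
rewrite [X in _ <= _ + X](eq_bigr (fun j => size (g j))) ?leq_add2r // => j ji.
by rewrite (negbTE ji).
Qed.

Lemma minimal_rev e A B n (g : 'I_n -> seq V) :
  minimal e A B g -> minimal (rv e) B A (fun i => rev (g i)).
Proof.
have tr (h : 'I_n -> seq V) : total (fun i => rev (h i)) = total h.
  by apply: eq_bigr => i _; rewrite size_rev.
have Lrev e1 A1 B1 (h : 'I_n -> seq V) : linkage e1 A1 B1 h -> linkage (rv e1) B1 A1 (fun i => rev (h i)).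
  move=> [hp hd]; split=> [i|i j v]; first by rewrite lpath_rev rev_uniq.
  by rewrite !mem_rev; apply: hd.
move=> [Lg min]; split; first exact: Lrev.
move=> g' /Lrev Lg'; rewrite tr -(tr g'); exact: min.
Qed.

(** * Consequences of minimal total length *)

Section Minimal.
Variables (e : rel V) (A B : {set V}) (n : nat) (g : 'I_n -> seq V).
Hypothesis ming : minimal e A B g.

Lemma minimal_uniq i : uniq (g i).
Proof. by have /andP [] := ming.1.1 i. Qed.

(** The path [x] followed by [g i] from [q] on is an admissible replacement, so at most one vertex
    precedes [q]. *)
Lemma shortcut1 x q i : x \in A -> (forall j, x \notin g j) -> q \in g i -> e x q -> q \in take 2 (g i).
Proof.
move=> xA xn qi exq; rewrite in_take // ltnS.
have us := minimal_uniq i; have /andP [lp _] := ming.1.1 i; have xi := xn i.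
have [s1 [s2 eq]] := split_at qi; rewrite eq in lp us xi.
have l2 := lpath_suffix lp (in_setT q).
have : size (g i) <= size (x :: q :: s2).
  apply: (exchange ming).
  - by move: l2; rewrite /= => /and3P [_ -> ->]; rewrite xA exq.
  - move: us xi; rewrite cat_uniq mem_cat negb_or (cons_uniq x).
    by case/and3P => _ _ -> /andP [_ ->].
  - move=> v; rewrite in_cons => /orP [/eqP ->|vs]; first by right.
    by left; rewrite eq mem_cat vs orbT.
rewrite eq size_cat /= index_cat; move: us; rewrite cat_uniq => /and3P [_ /hasPn/(_ q) H _].
by have := H (mem_head _ _) => /= /negbTE ->; rewrite eqxx; lia.
Qed.

Lemma shortcut2 x v q i : x \in A -> (forall j, x \notin g j) -> (forall j, v \notin g j) -> x != v ->
  q \in g i -> e x v -> e v q -> q \in take 3 (g i).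
Proof.
move=> xA xn vn xv qi exv evq; rewrite in_take // ltnS.
have us := minimal_uniq i; have /andP [lp _] := ming.1.1 i; have xi := xn i; have vi := vn i.
have [s1 [s2 eq]] := split_at qi; rewrite eq in lp us xi vi.
have l2 := lpath_suffix lp (in_setT q).
have : size (g i) <= size (x :: v :: q :: s2).
  apply: (exchange ming).
  - by move: l2; rewrite /= => /and3P [_ -> ->]; rewrite xA exv evq.
  - have nt w : w \notin s1 ++ q :: s2 -> w \notin q :: s2 by rewrite mem_cat; apply: contra => ->; rewrite orbT.
    have uq : uniq (q :: s2) by move: us; rewrite cat_uniq => /and3P [].
    by rewrite (cons_uniq x) (cons_uniq v) [x \in v :: _]in_cons (negbTE xv) /= nt // nt.
  - move=> w; rewrite !in_cons => /or3P [/eqP ->|/eqP ->|vs]; [by right|by right|].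
    by left; rewrite eq mem_cat in_cons vs orbT.
rewrite eq size_cat /= index_cat; move: us; rewrite cat_uniq => /and3P [_ /hasPn/(_ q) H _].
by have := H (mem_head _ _) => /= /negbTE ->; rewrite eqxx; lia.
Qed.

(** Following the chord gives a replacement within [g i], so nothing is skipped between [a] and a
    later [q]. Thus a vertex near the start loses at most 3 out-neighbours to its own path. *)
Lemma no_chord a q i : a \in take 2 (g i) -> q \in g i -> e a q -> q \in take 3 (g i).
Proof.
move=> a2 qi eaq; have ai := mem_take a2; move: a2; rewrite !in_take // ltnS => a1.
have us := minimal_uniq i; have /andP [lp _] := ming.1.1 i.
have [s1 [s2 eq]] := split_at ai; rewrite eq in lp us a1 qi *.
have := us; rewrite cat_uniq => /and3P [u1 /hasPn disj u2].
have as1 : a \in s1 = false by apply/negbTE/(disj a)/mem_head.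
rewrite index_cat as1 /= eqxx addn0 in a1.
rewrite index_cat; case: ifP => [|qs1].
  by rewrite -index_mem => /ltnW /leq_trans; apply; apply: leq_trans a1 _.
move: qi; rewrite mem_cat qs1 in_cons /= eq_sym; case: eqP => [_ _|_ /= qs2]; first by lia.
have [r1 [r2 eq2]] := split_at qs2; rewrite eq2 in eq lp us u2 disj *.
have le : size (g i) <= size (rcons s1 a ++ q :: r2).
  apply: (exchange ming).
  - apply: (@lpath_glue_edge _ _ setT _ setT _ _ _ _ eaq); first exact: lpath_prefix lp (in_setT _).
    by apply: (@lpath_suffix _ A _ _ (s1 ++ a :: r1)); rewrite ?in_setT // -catA.
  - rewrite cat_rcons; apply: subseq_uniq us; apply: cat_subseq => //=.
    by rewrite eqxx; apply: suffix_subseq.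
  - move=> v; rewrite cat_rcons => vs; left; rewrite eq; move: vs.
    by rewrite !mem_cat !in_cons mem_cat in_cons => /or4P [->|->|->|->]; rewrite ?orbT.
move: le; rewrite eq !(size_cat, size_rcons) /= !(size_cat, size_rcons) /= => le.
have -> : r1 = [::] by apply: size0nil; lia.
by rewrite /= eqxx; lia.
Qed.

End Minimal.
End Linkages.

(** * Selecting paths *)

Section Rounding.
Import GRing.Theory Num.Theory Order.TTheory.
Local Open Scope ring_scope.
Variables (R Q : finType) (a : R -> Q -> nat).

Lemma null_combination (S : {set Q}) : (#|R| < #|S|)%N ->
  exists z : Q -> rat, [/\ exists q, z q != 0, forall q, q \notin S -> z q = 0 &
    forall r, \sum_q (a r q)%:R * z q = 0].
Proof.
move=> RS; pose M := \matrix_(i < #|S|, j < #|R|) ((a (enum_val j) (enum_val i))%:R : rat).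
have : kermx M != 0.
  rewrite -mxrank_eq0 mxrank_ker subn_eq0 -ltnNge.
  exact: leq_ltn_trans (rank_leq_col M) RS.
move=> /rowV0Pn [v /sub_kermxP vM v0].
pose z q := \sum_(i < #|S|) v 0 i * (enum_val i == q)%:R.
have zE i : z (enum_val i) = v 0 i.
  rewrite /z (bigD1 i) //= eqxx mulr1 big1 ?addr0 // => j ji.
  by rewrite (inj_eq enum_val_inj) (negbTE ji) mulr0.
exists z; split.
- have /rV0Pn [i vi] := v0; by exists (enum_val i); rewrite zE.
- move=> q qS; rewrite /z big1 // => i _; case: eqP => [e|]; last by rewrite mulr0.
  by move: (enum_valP i); rewrite e (negbTE qS).
- move=> r; have := congr1 (fun w : 'rV_#|R| => w 0 (enum_rank r)) vM; rewrite !mxE => vMr.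
  transitivity (\sum_q \sum_(i < #|S|) (a r q)%:R * (v 0 i * (enum_val i == q)%:R)).
    by apply: eq_bigr => q _; rewrite /z big_distrr.
  rewrite exchange_big /=; apply: etrans vMr; apply: eq_bigr => i _; rewrite !mxE enum_rankK.
  rewrite (bigD1 (enum_val i)) //= eqxx mulr1 big1 ?addr0 1?mulrC // => q /negbTE.
  by rewrite eq_sym => ->; rewrite !mulr0.
Qed.

Definition fractional (x : Q -> rat) := [set q | 0 < x q < 1].

Lemma round_step (x : Q -> rat) : (forall q, 0 <= x q <= 1) -> (#|R| < #|fractional x|)%N ->
  exists y : Q -> rat, [/\ forall q, 0 <= y q <= 1, (#|fractional y| < #|fractional x|)%N,
    \sum_q x q <= \sum_q y q & forall r, \sum_q (a r q)%:R * y q = \sum_q (a r q)%:R * x q].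
Proof.
move=> x01 /null_combination [z0 [z0n z0S z0a]].
(* The kernel vector is negated if necessary, so that moving along it does not decrease the
   total. *)
have [z [[q0 zq0] zS za zpos]] : exists z : Q -> rat, [/\ exists q, z q != 0,
    forall q, q \notin fractional x -> z q = 0,
    forall r, \sum_q (a r q)%:R * z q = 0 & 0 <= \sum_q z q].
  case: (lerP 0 (\sum_q z0 q)) => s0; first by exists z0.
  exists (fun q => - z0 q); split.
  - by have [q zq] := z0n; exists q; rewrite oppr_eq0.
  - by move=> q /z0S ->; rewrite oppr0.
  - move=> r; under eq_bigr => q _ do rewrite mulrN.
    by rewrite sumrN z0a oppr0.
  - by rewrite sumrN oppr_ge0 ltW.
(* The longest step along [z] that keeps coordinate [q] in [0,1]. The minimum over the support of
   [z] makes the coordinate [q1] integral. *)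
pose b q := if 0 < z q then (1 - x q) / z q else x q / - z q.
have [q1 zq1 b1] : exists2 q1, z q1 != 0 & forall q, z q != 0 -> b q1 <= b q.
  by case: (@Order.TotalTheory.arg_minP _ _ _ q0 (fun q => z q != 0) b zq0) => q1 zq1 H; exists q1.
have xz q : z q != 0 -> 0 < x q < 1.
  by move=> zq; apply: contraNT zq => nx; rewrite zS // inE.
have bpos q : z q != 0 -> 0 < b q.
  move=> zq; have /andP [x0 x1] := xz q zq; rewrite /b; case: (ltrP 0 (z q)) => zs.
    by rewrite divr_gt0 // subr_gt0.
  by rewrite divr_gt0 // oppr_gt0 lt_neqAle zq.
pose y q := x q + b q1 * z q.
have y01 q : 0 <= y q <= 1.
  have /andP [x0 x1] := x01 q; case: (eqVneq (z q) 0) => zq; first by rewrite /y zq mulr0 addr0 x0.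
  have := b1 q zq; have := bpos q1 zq1; rewrite /y; move: (b q1) => c c0; rewrite /b.
  case: (ltrP 0 (z q)) => zs.
    rewrite ler_pdivlMr // => cz; have := mulr_gt0 c0 zs; lra.
  have zs' : 0 < - z q by rewrite oppr_gt0 lt_neqAle zq.
  rewrite ler_pdivlMr // mulrN => cz; have := mulr_gt0 c0 zs'; rewrite mulrN; lra.
exists y; split=> //.
- apply: proper_card; apply/properP; split.
    apply/subsetP => q; rewrite !inE => yq; apply: contraLR yq => xq.
    by rewrite /y zS ?inE // mulr0 addr0.
  exists q1; first by rewrite inE xz.
  rewrite inE /y /b; case: (ltrP 0 (z q1)) => zs.
    by rewrite divfK // addrC subrK ltxx andbF.
  by rewrite invrN mulrN mulNr divfK // subrr ltxx.
- rewrite big_split /= -big_distrr /= lerDl mulr_ge0 // ltW // bpos //.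
- move=> r; rewrite /y.
  under eq_bigr => q _ do rewrite mulrDr mulrCA.
  by rewrite big_split /= -big_distrr /= za mulr0 addr0.
Qed.

(* A vertex of the polytope cut out by the row constraints has at most |R| fractional coordinates. *)
Lemma half_rounding : exists F : {set Q},
  (forall r, 2 * \sum_(q in F) a r q <= \sum_q a r q)%N /\ (#|Q| <= 2 * #|F| + 2 * #|R|)%N.
Proof.
have [x [x01 xR xa xs]] : exists x : Q -> rat, [/\ forall q, 0 <= x q <= 1, (#|fractional x| <= #|R|)%N,
    forall r, \sum_q (a r q)%:R * x q = \sum_q (a r q)%:R * (1 / 2) & #|Q|%:R * (1 / 2) <= \sum_q x q].
  have [m] := ubnP #|Q|.
  suff H (x : Q -> rat) : (#|fractional x| < m)%N -> (forall q, 0 <= x q <= 1) ->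
      (forall r, \sum_q (a r q)%:R * x q = \sum_q (a r q)%:R * (1 / 2)) -> #|Q|%:R * (1 / 2) <= \sum_q x q ->
    exists x : Q -> rat, [/\ forall q, 0 <= x q <= 1, (#|fractional x| <= #|R|)%N,
      forall r, \sum_q (a r q)%:R * x q = \sum_q (a r q)%:R * (1 / 2) & #|Q|%:R * (1 / 2) <= \sum_q x q].
    move=> Qm; apply: (H (fun=> 1 / 2)) => //.
      by apply: leq_ltn_trans Qm; apply: max_card.
    by rewrite sumr_const mulr_natl.
  elim: m x => // m IHm x xm x01 xa xs.
  case: (leqP #|fractional x| #|R|) => [le|/(round_step x01) [y [y01 yx ys ya]]]; first by exists x.
  apply: (IHm y) => //; first by rewrite -ltnS; apply: leq_ltn_trans xm.
    by move=> r; rewrite ya xa.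
  exact: le_trans xs ys.
(* Rounding fractional coordinates down cannot raise a row sum, and it loses at most one element of
   [Q] per row. *)
pose F := [set q | x q == 1].
have xF q : ((q \in F)%:R <= x q) /\ (x q <= (q \in F)%:R + (q \in fractional x)%:R).
  have /andP [x0 x1] := x01 q; rewrite !inE.
  case: (eqVneq (x q) 1) => [->|n1] /=; first by split; lra.
  rewrite lt_neqAle x0 [x q < 1]lt_neqAle n1 x1 !andbT; split => //.
  by case: (eqVneq 0 (x q)) => [<-|] /=; lra.
exists F; split.
- move=> r; rewrite -(@ler_nat rat) natrM.
  have -> : (\sum_q a r q)%:R = 2 * \sum_q (a r q)%:R * x q :> rat.
    rewrite xa natr_sum big_distrr /=; apply: eq_bigr => q _; lra.
  rewrite ler_pM2l // natr_sum big_mkcond /=; apply: ler_sum => q _.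
  have [le _] := xF q; case: ifP => qF; rewrite qF in le.
    by rewrite -[leLHS]mulr1 ler_wpM2l.
  by rewrite mulr_ge0 // ler0n.
- have le : #|Q|%:R * (1 / 2) <= #|F|%:R + #|fractional x|%:R :> rat.
    apply: (le_trans xs); rewrite -!sum1_card !natr_sum [in X in _ <= X + _]big_mkcond.
    rewrite [X in _ <= _ + X]big_mkcond -big_split /=; apply: ler_sum => q _.
    by have [_] := xF q; do 2 case: ifP => _.
  have le2 : #|fractional x|%:R <= #|R|%:R :> rat by rewrite ler_nat.
  rewrite -(@ler_nat rat) natrD !natrM; lra.
Qed.

End Rounding.

(* A random 16-colouring puts only 1/16 of the total weight inside the colour classes. *)
Lemma sparse_subset (I : finType) (w : I -> I -> nat) B :
  (forall i, \sum_(j | j != i) w i j <= B) ->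
  exists F : {set I}, #|I| <= 32 * #|F| /\ forall i, i \in F -> 8 * \sum_(j in F | j != i) w i j <= B.
Proof.
move=> wB; pose same (f : {ffun I -> 'I_16}) i := \sum_(j | (j != i) && (f j == f i)) w i j.
have cnt i j : j != i -> 16 * #|[set f : {ffun I -> 'I_16} | f j == f i]| = 16 ^ #|I|.
  move=> ji; pose X c := [set f : {ffun I -> 'I_16} | (f j == c) && (f i == c)].
  have -> : #|[set f : {ffun I -> 'I_16} | f j == f i]| = \sum_(c : 'I_16) #|X c|.
    rewrite -sum1_card (partition_big (fun f : {ffun I -> 'I_16} => f i) predT) //=.
    apply: eq_bigr => c _; rewrite -sum1_card; apply: eq_bigl => f; rewrite !inE.
    by case: (eqVneq (f i) c) => [->|]; rewrite ?andbF.
  rewrite big_distrr /= -(card_ffun_ord I 16) -sum1_card.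
  rewrite (partition_big (fun f : {ffun I -> 'I_16} => f i) predT) //=; apply: eq_bigr => c _.
  rewrite (condition_colour (Q := fun f : {ffun I -> 'I_16} => f i == c)); last first.
    by move=> f f' ff'; rewrite ff' // eq_sym.
  by rewrite -sum1_card; apply: eq_bigl => f; rewrite inE.
have [f Hf] : exists f, 16 * \sum_i same f i <= #|I| * B.
  apply: Classical_Prop.NNPP => none.
  have : \sum_(f : {ffun I -> 'I_16}) (#|I| * B).+1 <= \sum_(f : {ffun I -> 'I_16}) 16 * \sum_i same f i.
    by apply: leq_sum => f _; rewrite ltnNge; apply/negP => le; apply: none; exists f.
  rewrite sum_nat_const card_ffun_ord -big_distrr /=.
  have -> : 16 * \sum_(f : {ffun I -> 'I_16}) \sum_i same f i =
      \sum_i \sum_(j | j != i) w i j * 16 ^ #|I|.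
    rewrite exchange_big /= big_distrr /=; apply: eq_bigr => i _.
    rewrite /same (eq_bigr (fun f : {ffun I -> 'I_16} => \sum_(j | j != i) w i j * (f j == f i))); last first.
      move=> f _; rewrite big_mkcondr; apply: eq_bigr => j _; by case: eqP; rewrite ?muln1 ?muln0.
    rewrite exchange_big /= big_distrr /=; apply: eq_bigr => j ji.
    rewrite -(cnt i j ji) -big_distrr /= mulnCA; congr (_ * (_ * _)).
    by rewrite -sum1dep_card [RHS]big_mkcond; apply: eq_bigr => f _; case: eqP.
  have : \sum_i \sum_(j | j != i) w i j * 16 ^ #|I| <= #|I| * B * 16 ^ #|I|.
    rewrite -mulnA -sum_nat_const; apply: leq_sum => i _; rewrite -big_distrl /=.
    by rewrite leq_mul.
  move=> le1 le2; have := leq_trans le2 le1; rewrite mulnC leq_pmul2r ?expn_gt0 //.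
  by rewrite ltnn.
(* By Markov at least half of the indices stay below twice the average bound B/16. The most frequent
   of 16 colours among them retains a 1/32 of all indices. *)
pose good := [set i | 8 * same f i <= B].
have cgood : #|I| <= 2 * #|good|.
  have : #|~: good| * B.+1 <= 8 * \sum_i same f i.
    rewrite -sum_nat_const big_distrr /= [X in _ <= X](bigID (mem (~: good))) /=.
    apply: leq_trans (leq_addr _ _); apply: leq_sum => i; by rewrite !inE -ltnNge.
  have := cardsC good; move: #|good| #|~: good| #|I| (\sum_i _) Hf => x y n s; nia.
have [c cF] : exists c : 'I_16, #|good| <= 16 * #|[set i in good | f i == c]|.
  apply: Classical_Prop.NNPP => none.
  have : \sum_(c : 'I_16) (16 * #|[set i in good | f i == c]|).+1 <= \sum_(c : 'I_16) #|good|.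
    by apply: leq_sum => c _; rewrite ltnNge; apply/negP => le; apply: none; exists c.
  rewrite sum_nat_const card_ord (eq_bigr (fun c => 16 * #|[set i in good | f i == c]| + 1)); last by move=> *; rewrite addn1.
  rewrite big_split /= sum1_card card_ord -big_distrr /=.
  have -> : \sum_(c : 'I_16) #|[set i in good | f i == c]| = #|good|.
    rewrite -[RHS]sum1_card (partition_big f predT) //=; apply: eq_bigr => c _.
    by rewrite -sum1_card; apply: eq_bigl => i; rewrite inE.
  by lia.
exists [set i in good | f i == c]; split; first by lia.
move=> i; rewrite inE => /andP [ig /eqP fi]; rewrite inE in ig; apply: leq_trans ig; rewrite leq_mul //.
rewrite /same [X in _ <= X](bigID (mem [set i in good | f i == c])) /=.
apply: leq_trans (leq_addr _ _); rewrite leq_eqVlt; apply/orP; left; apply/eqP; apply: eq_bigl => j.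
by rewrite !inE fi; case: (f j == c); rewrite ?andbF ?andbT //= andbC.
Qed.

(** * Hubs and forced paths *)

Section Degrees.
Variables (V : finType) (E : rel V).

Lemma kconn_rv K : strongly_kconnected_on E K [set: V] -> strongly_kconnected_on (rv E) K [set: V].
Proof.
move=> [KV con]; split=> // Z ZV ZK u v uZ vZ.
by rewrite connect_restrict_rv; apply: con.
Qed.

Lemma tour_rv : is_tournament E -> is_tournament (rv E).
Proof. by move=> [irr tot]; split=> [u|u v uv]; rewrite /rv ?irr // addbC; apply: tot. Qed.

(** Deleting fewer than [K] out-neighbours would leave [v] without an exit while another vertex
    remains. *)
Lemma kconn_out K : is_tournament E -> strongly_kconnected_on E K [set: V] ->
  forall v, K <= #|out E v|.
Proof.
move=> [irr _] [KV con] v; rewrite leqNgt; apply/negP => small.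
have [w] : exists2 w, w \in [set: V] & w \notin v |: out E v.
  by apply: card_gt_notin KV _; rewrite cardsU1 inE irr; lia.
rewrite in_setU1 negb_or => _ /andP [wv wO].
have vO : v \notin out E v by rewrite inE irr.
have := con (out E v) (subsetT _) small v w; rewrite !in_setD vO wO !in_setT => /(_ isT isT).
case/connectP => [[|y p]] /=; first by move=> _ e; rewrite e eqxx in wv.
by case/andP => /and3P [_]; rewrite inE inE => /andP [/negbTE -> _].
Qed.

Lemma menger_tournament (X Y : {set V}) K M : strongly_kconnected_on E K [set: V] ->
  M <= K -> M <= #|X| -> M <= #|Y| -> exists g : 'I_M -> seq V, linkage E X Y g.
Proof.
move=> [_ con] MK MX MY; apply: menger => S sepS; rewrite leqNgt; apply/negP => SM.
have [x xX xS] := card_gt_notin MX SM; have [y yY yS] := card_gt_notin MY SM.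
have := con S (subsetT _) (leq_trans SM MK) x y; rewrite !in_setD xS yS !in_setT => /(_ isT isT).
case/connectP => p pth lst.
have /sepS : lpath E X Y (x :: p).
  rewrite /= xX -lst yY /=; apply: sub_path pth => a b; by case/and3P.
case/hasP => z zp zS; move: zp; rewrite in_cons => /orP [/eqP e|].
  by move: xS; rewrite -e => /negP; apply.
elim: p x pth {xX xS lst} => //= b p IHp x /andP [/and3P [_ bS _] pth].
rewrite in_cons => /orP [/eqP e|]; last exact: IHp pth.
by move: bS; rewrite -e in_setD => /andP [/negP].
Qed.

End Degrees.

Lemma lowest (V : finType) (f : V -> nat) (A : {set V}) h : h <= #|A| ->
  exists (X : {set V}) (D : nat), [/\ X \subset A, #|X| = h, forall x, x \in X -> f x <= D &
    forall v, v \in A -> v \notin X -> D <= f v].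
Proof.
elim: h => [|h IHh] hA; first by exists set0, 0; rewrite sub0set cards0; split=> // x; rewrite inE.
have [X [D [XA cX XD vD]]] := IHh (ltnW hA).
have [x0 x0A x0X] : exists2 x, x \in A & x \notin X by apply: card_gt_notin hA _; rewrite cX.
have P0 : (x0 \in A) && (x0 \notin X) by rewrite x0A.
case: (@arg_minnP V x0 (fun x => (x \in A) && (x \notin X)) f P0) => x /andP [xA xX] xmin.
exists (x |: X), (f x); split.
- by rewrite subUset sub1set xA.
- by rewrite cardsU1 xX cX.
- by move=> y; rewrite !inE => /orP [/eqP -> //|/XD le]; apply: leq_trans le (vD _ xA xX).
- by move=> v vA; rewrite !inE negb_or => /andP [_ vX]; apply: xmin; rewrite vA.
Qed.

Lemma split_hubs (V : finType) (A : {set V}) T m : T * m <= #|A| ->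
  exists U : 'I_T -> {set V}, [/\ forall i, U i \subset A, forall i, #|U i| = m &
    forall i i' v, v \in U i -> v \in U i' -> i = i'].
Proof.
move=> TA; have [h hinj hA] : exists2 h : 'I_T * 'I_m -> V, injective h & forall p, h p \in A.
  by apply: embed_into; rewrite card_prod !card_ord.
exists (fun i => [set h (i, j) | j : 'I_m]); split=> [i|i|i i' v].
- by apply/subsetP => v /imsetP [j _ ->].
- by rewrite card_imset ?card_ord // => j j' /hinj [].
- by case/imsetP => j _ -> /imsetP [j' _] /hinj [].
Qed.

(* The forced path P i j is g (phi (i, j)) as a set only, so that reversing all edges preserves the setting. *)
Record setting (V : finType) (E : rel V) (t k T M K D : nat) (X Y : {set V})
    (g : 'I_M -> seq V) (phi : 'I_T * 'I_k -> 'I_M) (U W : 'I_T -> {set V})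
    (P : 'I_T -> 'I_k -> seq V) (L : 'I_T -> {set V}) (Cs : {set V}) : Prop := Setting {
  s_T : T = 2 * t;
  s_K : 100 * 1000 * (k * t) <= K;
  s_kt : 0 < k * t;
  s_tour : is_tournament E;
  s_deg : forall v, K <= #|out E v|;
  s_min : minimal E X Y g;
  s_low : forall x, x \in X -> #|out E x| <= D;
  s_high : forall v, v \notin X -> v \notin Y -> D <= #|out E v|;
  s_UX : forall i u, u \in U i -> u \in X /\ forall j, u \notin g j;
  s_WY : forall i u, u \in W i -> u \in Y /\ forall j, u \notin g j;
  s_cU : forall i, #|U i| = 21 * k;
  s_cW : forall i, #|W i| = 21 * k;
  s_P : forall i j v, (v \in P i j) = (v \in g (phi (i, j)));
  s_L : forall i v, (v \in L i) = [|| [exists j, v \in P i j], v \in U i | v \in W i];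
  s_XC : X \subset Cs;
  s_YC : Y \subset Cs }.

(** * From a minimal linkage to the [side] conditions *)

Section OneSide.
Variables (V : finType) (E : rel V) (t k T M K D : nat).
Variables (X Y : {set V}) (g : 'I_M -> seq V) (phi : 'I_T * 'I_k -> 'I_M).
Variables (U W : 'I_T -> {set V}) (P : 'I_T -> 'I_k -> seq V) (L : 'I_T -> {set V}) (Cs : {set V}).
Hypothesis S : setting E t K D X Y g phi U W P L Cs.
Let TE := s_T S.
Let K_large := s_K S.
Let kt0 := s_kt S.
Let tour := s_tour S.
Let deg := s_deg S.
Let ming := s_min S.
Let lowX := s_low S.
Let high := s_high S.
Let UX := s_UX S.
Let WY := s_WY S.
Let cU := s_cU S.
Let cW := s_cW S.
Let PE := s_P S.
Let LE := s_L S.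
Let XC := s_XC S.
Let YC := s_YC S.

Local Notation forced := (forced L).
Local Notation Mid := (forced :\: Cs).

Definition hubs := \bigcup_i (U i :|: W i).

Lemma card_hubs : #|hubs| <= 84 * (k * t).
Proof.
apply: leq_trans (card_bigcup_le _ _) _; apply: (@leq_trans (\sum_(i : 'I_T) 42 * k)); last first.
  by rewrite sum_nat_const card_ord TE; lia.
by apply: leq_sum => i _; have := (leq_card_setU (U i) (W i)).1; rewrite cU cW; lia.
Qed.

Lemma forced_cover v : v \in forced -> (exists p, v \in g (phi p)) \/ v \in hubs.
Proof.
case/bigcupP => i _; rewrite LE => /or3P [/existsP [j]|vU|vW].
- by rewrite PE => vg; left; exists (i, j).
- by right; apply/bigcupP; exists i; rewrite // in_setU vU.
- by right; apply/bigcupP; exists i; rewrite // in_setU vW orbT.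
Qed.

Lemma path_forced p v : v \in g (phi p) -> v \in forced.
Proof.
case: p => i j vg; apply/bigcupP; exists i => //; rewrite LE; apply/or3P; apply: Or31.
by apply/existsP; exists j; rewrite PE.
Qed.

(** There are 2kt forced paths and at most 84kt hubs; with [m] equal to 2, 3 and 4 this yields the
    bounds 88, 90 and 92. *)
Lemma card_forced_cap (A : {set V}) m : (forall p, #|A :&: [set v in g (phi p)]| <= m) ->
  #|A :&: forced| <= 2 * (k * t) * m + 84 * (k * t).
Proof.
move=> Am; have sub : A :&: forced \subset (\bigcup_p (A :&: [set v in g (phi p)])) :|: hubs.
  apply/subsetP => v; rewrite in_setI => /andP [vA /forced_cover [[p vp]|vh]]; last first.
    by rewrite in_setU vh orbT.
  by rewrite in_setU; apply/orP; left; apply/bigcupP; exists p; rewrite // !inE vA.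
apply: leq_trans (card_le_setU sub) (leq_add _ card_hubs).
apply: leq_trans (card_bigcup_le _ _) _; apply: leq_trans (leq_sum _ (fun p _ => Am p)) _.
by rewrite sum_nat_const card_prod !card_ord TE leq_mul //; lia.
Qed.

Lemma card_in_take (A : {set V}) (s : seq V) m :
  (forall v, v \in A -> v \in s -> v \in take m s) -> #|A :&: [set v in s]| <= m.
Proof.
move=> Am; apply: (@leq_trans #|[set v in take m s]|).
  by apply: subset_leq_card; apply/subsetP => v; rewrite !inE => /andP [vA]; apply: Am.
by rewrite cardsE; apply: leq_trans (card_size _) _; rewrite size_take; case: ltnP.
Qed.

Lemma unused_out x : x \in X -> (forall j, x \notin g j) -> #|out E x :&: forced| <= 88 * (k * t).
Proof.
move=> xX xn; have := @card_forced_cap (out E x) 2; rewrite (_ : 2 * _ * 2 + _ = 88 * (k * t)); last by lia.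
apply=> p; apply: card_in_take => v; rewrite inE => Exv vg.
exact: (shortcut1 ming xX xn vg Exv).
Qed.

Lemma nonpath_out x v : x \in X -> (forall j, x \notin g j) -> (forall j, v \notin g j) -> x != v ->
  E x v -> #|out E v :&: forced| <= 90 * (k * t).
Proof.
move=> xX xn vn xv Exv; have := @card_forced_cap (out E v) 3; rewrite (_ : 2 * _ * 3 + _ = 90 * (k * t)); last by lia.
apply=> p; apply: card_in_take => w; rewrite inE => Evw wg.
exact: (shortcut2 ming xX xn vn xv wg Exv Evw).
Qed.

Lemma late_to_all i v : v \in g i -> v \notin take 2 (g i) -> to_all E U v.
Proof.
move=> vi v2 a u /UX [uX un]; have [_ tot] := tour.
have vu : v != u by apply: contraTneq vi => ->; apply: un.
have := tot v u vu; case: (E v u) => //=; case: (boolP (E u v)) => // Euv _.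
by move: v2; rewrite (shortcut1 ming uX un vi Euv).
Qed.

Lemma free_side v : v \notin Cs -> (forall i, v \in take 2 (g i) -> v \in Cs) ->
  to_all E U v \/ #|out E v :&: forced| <= 90 * (k * t).
Proof.
move=> vC C1; case: (classic (exists i, v \in g i)) => [[i vi]|vn].
  by left; apply: (late_to_all vi); apply: contra vC; apply: C1.
have {}vn j : v \notin g j by apply/negP => vj; apply: vn; exists j.
case: (classic (to_all E U v)) => [|nall]; [by left | right].
have [i [u [uU nvu]]] : exists i u, u \in U i /\ ~~ E v u.
  apply: NNPP => none; apply: nall => i u uU; apply: contraT => nvu.
  by case: none; exists i, u.
have [uX un] := UX uU; have vu : v != u by apply: contraNneq vC => ->; apply: (subsetP XC).
apply: (nonpath_out uX un vn); first by rewrite eq_sym.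
by have [_ tot] := tour; have := tot v u vu; rewrite (negbTE nvu).
Qed.

Lemma unused_cared x : x \in X -> (forall j, x \notin g j) -> cared P L Mid E U K x.
Proof.
move=> xX xn; apply: Or33; have := unused_out xX xn; have := deg x.
have := cardsID forced (out E x).
by move: #|out E x :&: forced| #|out E x :\: forced| #|out E x| => a b c; lia.
Qed.

(* The third vertex of a forced path is joined to all hubs in both directions, hence is in Mid. *)
Lemma unused_rich y : (forall p, 4 < size (g (phi p))) ->
  (forall p v, v \in g (phi p) -> v \notin take 2 (g (phi p)) -> v \notin take 2 (rev (g (phi p))) -> v \notin Cs) ->
  y \in Y -> (forall j, y \notin g j) -> cared P L Mid E U K y.
Proof.
move=> long Cmid yY yn; apply: Or31 => i j; set s := g (phi (i, j)).
have us : uniq s := minimal_uniq ming _.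
have sz : 4 < size s := long _.
pose q := nth y s 2.
have s2 : 2 < size s by apply: leq_trans sz.
have qs : q \in s by apply: mem_nth.
have q1 : q \notin take 2 s by rewrite in_take // /q index_uniq.
have q2 : q \notin take 2 (rev s).
  have -> : q = nth y (rev s) (size s - 3) by rewrite nth_rev ?/q; [congr nth|]; move: sz; move: (size s) => n; lia.
  rewrite in_take ?mem_nth ?size_rev ?index_uniq ?rev_uniq ?size_rev //;
    by move: sz; move: (size s) => n; lia.
have [_ tot] := tour; have yq : y != q by apply: contraTneq qs => <-; apply: yn.
have yn' j' : y \notin rev (g j') by rewrite mem_rev.
exists q; first by rewrite PE.
rewrite in_setD (Cmid (i, j)) // (@path_forced (i, j)) // andbT.
have := tot y q yq; case: (boolP (E y q)) => //= _ Eqy.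
by move: q2; rewrite (shortcut1 (minimal_rev ming) yY yn' _ Eqy) // mem_rev.
Qed.

(** Of [K] out-neighbours at most K/2 lie on other forced paths, 3 on the path of [v] and 84kt among
    the hubs, so more than K/4 are unforced. *)
Lemma start_cared p v : v \in take 2 (g (phi p)) ->
  2 * (\sum_(p' | p' != p) #|trunc K (out E v) :&: [set w in g (phi p')]|) <= K ->
  cared P L Mid E U K v.
Proof.
move=> v2 sel; apply: Or33; set N := trunc K (out E v) in sel.
have cN : #|N| = K by apply: card_trunc.
have Nsub : N \subset out E v := trunc_sub _ _.
have own : #|N :&: [set w in g (phi p)]| <= 3.
  apply: card_in_take => w wN wg; apply: (no_chord ming v2 wg).
  by have := subsetP Nsub w wN; rewrite inE.
have sub : N :&: forced \subset (\bigcup_p (N :&: [set v in g (phi p)])) :|: hubs.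
  apply/subsetP => w; rewrite in_setI => /andP [wN /forced_cover [[p' wp]|wh]]; last first.
    by rewrite in_setU wh orbT.
  by rewrite in_setU; apply/orP; left; apply/bigcupP; exists p'; rewrite // in_setI wN inE.
have le1 := card_le_setU sub; have le2 := card_hubs.
have le3 := card_bigcup_le predT (fun p => N :&: [set v in g (phi p)]).
have le4 : \sum_p' #|N :&: [set w in g (phi p')]| <= K %/ 2 + 3.
  by rewrite (bigD1 p) //= addnC leq_add //; move: sel; move: (\sum_(_ | _) _) => x; lia.
have le5 : #|N :\: forced| <= #|out E v :\: forced| by rewrite subset_leq_card ?setSD.
have := cardsID forced N; rewrite cN.
have := leq_trans le1 (leq_add (leq_trans le3 le4) le2).
by move: #|N :&: forced| #|N :\: forced| le5 => x y; lia.
Qed.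

Lemma rounded_cared v : 2 * (\sum_p #|out E v :&: [set w in g (phi p)]|) <= #|out E v| ->
  cared P L Mid E U K v.
Proof.
move=> sel; apply: Or33.
have sub : out E v :&: forced \subset (\bigcup_p (out E v :&: [set v in g (phi p)])) :|: hubs.
  apply/subsetP => w; rewrite in_setI => /andP [wN /forced_cover [[p' wp]|wh]]; last first.
    by rewrite in_setU wh orbT.
  by rewrite in_setU; apply/orP; left; apply/bigcupP; exists p'; rewrite // in_setI wN inE.
have le1 := card_le_setU sub; have le2 := card_hubs.
have le3 := card_bigcup_le predT (fun p => out E v :&: [set v in g (phi p)]).
have := cardsID forced (out E v); have := deg v.
have := leq_trans le1 (leq_add le3 le2).
by move: (\sum_p _) #|out E v :&: forced| #|out E v :\: forced| #|out E v| sel => s x y z; lia.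
Qed.

(** If fewer than K/4 out-neighbours are unforced, over 3K/4 are forced. Those outside [Mid] are
    hubs or among the four end vertices of a forced path, O(kt) in all. *)
Lemma start_trapped v :
  (forall p v, v \in g (phi p) -> v \notin take 2 (g (phi p)) -> v \notin take 2 (rev (g (phi p))) -> v \notin Cs) ->
  cared P L Mid E U K v \/ K <= 4 * #|out E v :&: Mid|.
Proof.
move=> Cmid; case: (leqP K (4 * #|out E v :\: forced|)) => [le|lt]; [by left; apply: Or33 | right].
pose ends p := [set w in take 2 (g (phi p))] :|: [set w in take 2 (rev (g (phi p)))].
have sub : out E v :&: forced \subset (out E v :&: Mid) :|: ((\bigcup_p ends p) :|: hubs).
  apply/subsetP => w; rewrite in_setI => /andP [wO wF]; rewrite in_setU in_setI wO /=.
  case: (boolP (w \in Cs)) => wC; last by rewrite in_setD wC wF.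
  apply/orP; right; rewrite in_setU; case: (forced_cover wF) => [[p wp]|->]; last by rewrite orbT.
  apply/orP; left; apply/bigcupP; exists p => //; rewrite !inE; apply/norP => -[w1 w2].
  by move: (Cmid p w wp w1 w2); rewrite wC.
have cends p : #|ends p| <= 4.
  apply: leq_trans (leq_card_setU _ _).1 _; apply: (@leq_add _ _ 2 2).
    by rewrite cardsE; apply: leq_trans (card_size _) _; rewrite size_take; case: ltnP.
  by rewrite cardsE; apply: leq_trans (card_size _) _; rewrite size_take; case: ltnP.
have le3 : #|\bigcup_p ends p| <= 8 * (k * t).
  apply: leq_trans (card_bigcup_le _ _) _; apply: leq_trans (leq_sum _ (fun p _ => cends p)) _.
  by rewrite sum_nat_const card_prod !card_ord TE; lia.
have le1 := card_le_setU sub; have le2 := card_hubs.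
have le4 := (leq_card_setU (\bigcup_p ends p) hubs).1.
have := cardsID forced (out E v); have := deg v.
have := leq_trans le1 (leq_add (leqnn _) (leq_trans le4 (leq_add le3 le2))).
by move: #|out E v :&: Mid| #|out E v :&: forced| #|out E v :\: forced| #|out E v| lt => s x y z; lia.
Qed.

Lemma side_long st :
  (forall i j, st i j \in X) ->
  (forall p, 4 < size (g (phi p))) ->
  (forall i v, v \in take 2 (g i) -> v \in Cs) ->
  (forall p v, v \in g (phi p) -> v \notin take 2 (g (phi p)) -> v \notin take 2 (rev (g (phi p))) -> v \notin Cs) ->
  (forall p v, v \in take 2 (g (phi p)) ->
    2 * (\sum_(p' | p' != p) #|trunc K (out E v) :&: [set w in g (phi p')]|) <= K) ->
  side P L Cs Mid E U st K D (100 * (k * t)).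
Proof.
move=> stX long C1 Cmid sel; split=> //.
- by move=> i u /UX [uX _]; apply: lowX.
- by move=> i j; apply: lowX.
- by move=> i j; apply: (subsetP XC).
- move=> v vC; apply: high; apply: contra vC; [exact: (subsetP XC) | exact: (subsetP YC)].
- by move=> i u /UX [uX un]; have := unused_out uX un; lia.
- move=> v vC _; case: (free_side vC (fun i => C1 i v)) => [all|le]; [by left | by right; lia].
- move=> v; rewrite in_setD => /andP [vC /forced_cover [[p vp]|]].
    by apply: (late_to_all vp); apply: contra vC; apply: C1.
  case/bigcupP => i _; rewrite in_setU => /orP [/UX [vX _]|/WY [vY _]].
    by move: vC; rewrite (subsetP XC).
  by move: vC; rewrite (subsetP YC).
- move=> v vF vC; case: (forced_cover vF) => [[p vp]|].
    case: (boolP (v \in take 2 (g (phi p)))) => v2; last by apply: Or32; apply: late_to_all vp v2.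
    exact: start_cared v2 (sel _ _ v2).
  case/bigcupP => i _; rewrite in_setU => /orP [/UX [vX vn]|/WY [vY vn]]; first exact: unused_cared.
  exact: unused_rich.
- by move=> i; apply/subsetP => u uU; rewrite LE uU orbT.
- by move=> i; apply/subsetP => u /UX [uX _]; apply: (subsetP XC).
Qed.

Lemma forced_short : (forall p, size (g (phi p)) <= 4) -> #|forced| <= 92 * (k * t).
Proof.
move=> short; rewrite -[forced]setTI.
have := @card_forced_cap setT 4; rewrite (_ : 2 * _ * 4 + _ = 92 * (k * t)); last by lia.
apply=> p; apply: card_in_take => v _ vg; rewrite take_oversize //; exact: short.
Qed.

Lemma short_cared v : (forall p, size (g (phi p)) <= 4) -> cared P L Mid E U K v.
Proof.
move=> /forced_short small; apply: Or33; have := deg v; have := cardsID forced (out E v).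
have := subset_leq_card (subsetIr (out E v) forced).
by move: #|out E v :&: forced| #|out E v :\: forced| #|out E v| #|forced| small => a b c d; lia.
Qed.

Lemma side_short st : (forall i j, st i j \in X) -> (forall p, size (g (phi p)) <= 4) -> forced \subset Cs ->
  side P L Cs Mid E U st K D (100 * (k * t)).
Proof.
move=> stX short FC; have small := forced_short short.
have cap v : #|out E v :&: forced| <= 100 * (k * t).
  by have := leq_trans (subset_leq_card (subsetIr (out E v) forced)) small; lia.
split=> //.
- by move=> i u /UX [uX _]; apply: lowX.
- by move=> i j; apply: lowX.
- by move=> i j; apply: (subsetP XC).
- move=> v vC; apply: high; apply: contra vC; [exact: (subsetP XC) | exact: (subsetP YC)].
- by move=> v _ _; right.
- by move=> v; rewrite in_setD => /andP [vC /(subsetP FC)]; rewrite (negbTE vC).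
- by move=> v _ _; apply: short_cared.
- by move=> i; apply/subsetP => u uU; rewrite LE uU orbT.
- by move=> i; apply/subsetP => u /UX [uX _]; apply: (subsetP XC).
Qed.

End OneSide.

Section Heads.
Variables (V : finType) (E : rel V) (X Y : {set V}) (M : nat) (g : 'I_M -> seq V).
Hypothesis ming : minimal E X Y g.

(** The part of [g i] from [x] on is itself a path from [X] to [Y], so minimality leaves nothing
    before [x]. *)
Lemma only_head x i : x \in X -> x \in g i -> exists p, g i = x :: p.
Proof.
move=> xX xi; have us := minimal_uniq ming i; have /andP [lp _] := ming.1.1 i.
have [s1 [s2 eq]] := split_at xi; rewrite eq in lp us.
have : size (g i) <= size (x :: s2).
  apply: (exchange ming); first exact: lpath_suffix lp xX.
    by move: us; rewrite cat_uniq => /and3P [].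
  by move=> v vs; left; rewrite eq mem_cat vs orbT.
rewrite eq size_cat /= => le; have -> : s1 = [::] by apply: size0nil; lia.
by exists s2.
Qed.

Lemma heads : exists s : 'I_M -> V, forall i, s i \in X /\ exists p, g i = s i :: p.
Proof.
apply: (@fin_all_exists _ _ (fun i x => x \in X /\ exists p, g i = x :: p)) => i.
have /andP [] := ming.1.1 i; case: (g i) => // x p /and3P [xX _ _] _.
by exists x; split=> //; exists p.
Qed.

Definition unused := [set x in X | [forall i, x \notin g i]].

Lemma card_unused : #|X| <= #|unused| + M.
Proof.
have [s sE] := heads.
have : X \subset unused :|: [set s i | i : 'I_M].
  apply/subsetP => x xX; rewrite !inE xX /=; case: (boolP [forall i, x \notin g i]) => //= /forallPn [i].
  rewrite negbK => xi; apply/imsetP; exists i => //.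
  by have [p e] := only_head xX xi; have [_ [q]] := sE i; rewrite e => -[].
move=> /card_le_setU /leq_trans; apply; rewrite leq_add2l.
by apply: leq_trans (leq_imset_card _ _) _; rewrite card_ord.
Qed.

Lemma unusedP x : x \in unused -> x \in X /\ forall i, x \notin g i.
Proof. by rewrite inE => /andP [xX /forallP xn]. Qed.

End Heads.

Lemma disjoint_sum (V I : finType) (N : {set V}) (G : I -> seq V) :
  (forall i j v, v \in G i -> v \in G j -> i = j) ->
  \sum_i #|N :&: [set w in G i]| <= #|N|.
Proof.
move=> disj; apply: (@leq_trans (\sum_i #|[set w | (w \in N) && (w \in G i)]|)).
  by apply: leq_sum => i _; apply: subset_leq_card; apply/subsetP => w; rewrite !inE.
rewrite (sum_card_dep (fun i w => (w \in N) && (w \in G i))) -sum1_card [X in _ <= X]big_mkcond.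
apply: leq_sum => v _; case: ifP => vN; last first.
  by rewrite leqn0 cards_eq0; apply/eqP/setP => i; rewrite !inE.
apply: (leq_trans (_ : _ <= 1)) => //.
by apply/card_le1P => i; rewrite inE /= => vi j; rewrite !inE; apply/idP/eqP => [vj|->//]; apply: disj vj vi.
Qed.

Lemma leq_sum_mem (V : eqType) (s : seq V) (F : V -> nat) v : v \in s -> F v <= \sum_(w <- s) F w.
Proof. by move=> vs; rewrite (big_rem v vs) leq_addr. Qed.

Lemma leq_sum_const (V : eqType) (s : seq V) (F : V -> nat) m : (forall v, v \in s -> F v <= m) ->
  \sum_(w <- s) F w <= size s * m.
Proof.
move=> Fm; rewrite big_seq; apply: leq_trans (leq_sum _ (fun v vs => Fm v vs)) _.
by rewrite -big_seq big_const_seq count_predT iter_addn_0 mulnC.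
Qed.

Lemma leq_sum_inj (I J : finType) (h : I -> J) (A : pred I) (B : pred J) (f : J -> nat) :
  injective h -> (forall i, A i -> B (h i)) -> \sum_(i | A i) f (h i) <= \sum_(j | B j) f j.
Proof.
move=> hinj AB; have <- : \sum_(j in [set h i | i in A]) f j = \sum_(i | A i) f (h i).
  by rewrite big_imset //= => i i' _ _; apply: hinj.
rewrite [X in _ <= X](bigID (mem [set h i | i in A])) /=; apply: leq_trans (leq_addr _ _).
rewrite leq_eqVlt; apply/orP; left; apply/eqP; apply: eq_bigl => j.
by case: (boolP (j \in _)) => [/imsetP [i iA ->]|]; rewrite ?andbF // AB.
Qed.

(** * Choice of the forced paths: many short paths, or few *)

Section Build.
Variables (V : finType) (E : rel V) (t k K D D' : nat) (X Y : {set V}).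
Let T := 2 * t.
Variables (g : 'I_(170 * (k * t)) -> seq V) (U W : 'I_T -> {set V}).
Hypothesis k0 : 0 < k.
Hypothesis t0 : 0 < t.
Hypothesis K_large : 100 * 1000 * (k * t) <= K.
Hypothesis tour : is_tournament E.
Hypothesis deg : forall v, K <= #|out E v|.
Hypothesis deg' : forall v, K <= #|out (rv E) v|.
Hypothesis ming : minimal E X Y g.
Hypothesis cX : #|X| = 212 * (k * t).
Hypothesis cY : #|Y| = 212 * (k * t).
Hypothesis XY : forall v, v \in X -> v \in Y -> False.
Hypothesis lowX : forall x, x \in X -> #|out E x| <= D.
Hypothesis lowY : forall x, x \in Y -> #|out (rv E) x| <= D'.
Hypothesis high : forall v, v \notin X -> v \notin Y -> D <= #|out E v|.
Hypothesis high' : forall v, v \notin Y -> v \notin X -> D' <= #|out (rv E) v|.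
Hypothesis UX : forall i u, u \in U i -> u \in X /\ forall j, u \notin g j.
Hypothesis WY : forall i u, u \in W i -> u \in Y /\ forall j, u \notin g j.
Hypothesis cU : forall i, #|U i| = 21 * k.
Hypothesis cW : forall i, #|W i| = 21 * k.
Hypothesis U_disj : forall i i' v, v \in U i -> v \in U i' -> i = i'.
Hypothesis W_disj : forall i i' v, v \in W i -> v \in W i' -> i = i'.

Local Notation g' := (fun i => rev (g i)).
Let kt0 : 0 < k * t. Proof. by rewrite muln_gt0 k0. Qed.
Let ming' : minimal (rv E) Y X g' := minimal_rev ming.
Let tour' : is_tournament (rv E) := tour_rv tour.
Let WY' i u : u \in W i -> u \in Y /\ forall j, u \notin rev (g j).
Proof. by move=> /WY [uY un]; split=> // j; rewrite mem_rev. Qed.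
Let UX' i u : u \in U i -> u \in X /\ forall j, u \notin rev (g j).
Proof. by move=> /UX [uY un]; split=> // j; rewrite mem_rev. Qed.

Section Choice.
Variables (phi : 'I_T * 'I_k -> 'I_(170 * (k * t))) (Cs : {set V}).
Hypothesis phi_inj : injective phi.
Hypothesis XC : X \subset Cs.
Hypothesis YC : Y \subset Cs.

Definition fpath i j := g (phi (i, j)).
Definition layer i := [set v | [|| [exists j, v \in fpath i j], v \in U i | v \in W i]].

Lemma PE i j v : (v \in fpath i j) = (v \in g (phi (i, j))).
Proof. by []. Qed.

Lemma PE' i j v : (v \in fpath i j) = (v \in rev (g (phi (i, j)))).
Proof. by rewrite mem_rev. Qed.

Lemma LE i v : (v \in layer i) = [|| [exists j, v \in fpath i j], v \in U i | v \in W i].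
Proof. by rewrite inE. Qed.

Lemma LE' i v : (v \in layer i) = [|| [exists j, v \in fpath i j], v \in W i | v \in U i].
Proof. by rewrite inE [(v \in W i) || _]orbC. Qed.

Lemma L_disj i i' v : v \in layer i -> v \in layer i' -> i = i'.
Proof.
rewrite !LE => /or3P [/existsP [j vP]|vU|vW] /or3P [/existsP [j' vP']|vU'|vW'].
- by have /phi_inj [] := ming.1.2 _ _ _ vP vP'.
- by have [_ /(_ (phi (i, j)))] := UX vU'; rewrite -PE vP.
- by have [_ /(_ (phi (i, j)))] := WY vW'; rewrite -PE vP.
- by have [_ /(_ (phi (i', j')))] := UX vU; rewrite -PE vP'.
- exact: U_disj vU vU'.
- by case: (XY (UX vU).1 (WY vW').1).
- by have [_ /(_ (phi (i', j')))] := WY vW; rewrite -PE vP'.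
- by case: (XY (UX vU').1 (WY vW).1).
- exact: W_disj vW vW'.
Qed.

Lemma setting1 : setting E t K D X Y g phi U W fpath layer Cs.
Proof. by split=> //; exact: LE. Qed.

Lemma setting2 : setting (rv E) t K D' Y X g' phi W U fpath layer Cs.
Proof. by split=> //; [exact: PE' | exact: LE']. Qed.

Local Notation Mid := (forced layer :\: Cs).

Lemma build :
  #|Cs| <= 1200 * (k * t) ->
  (forall st, (forall i j, st i j \in X) -> side fpath layer Cs Mid E U st K D (100 * (k * t))) ->
  (forall st, (forall i j, st i j \in Y) -> side fpath layer Cs Mid (rv E) W st K D' (100 * (k * t))) ->
  (forall v, v \in Cs -> v \notin forced layer ->
    [\/ cared fpath layer Mid E U K v /\ cared fpath layer Mid (rv E) W K v,
        to_all (rv E) W v /\ K <= 4 * #|out E v :&: Mid| |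
        to_all E U v /\ K <= 4 * #|out (rv E) v :&: Mid|]) ->
  exists Q : {set {set V}},
    [/\ partition Q [set: V], #|Q| = t & forall Vi, Vi \in Q -> strongly_kconnected_on E k Vi].
Proof.
move=> Cs_small side1 side2 special.
have [s sE] := heads ming; have [e eE] := heads ming'.
have P_path i j : exists p, [/\ fpath i j = s (phi (i, j)) :: p, path E (s (phi (i, j))) p &
    last (s (phi (i, j))) p = e (phi (i, j))].
  have [_ [p ep]] := sE (phi (i, j)); exists p; rewrite /fpath ep; split=> //.
    by have /andP [] := ming.1.1 (phi (i, j)); rewrite ep => /and3P [].
  have [_ [q eq]] := eE (phi (i, j)); move: eq; rewrite ep lastI rev_rcons; by case.
apply: (assembly k0 t0 (erefl T) (side1 (fun i j => s (phi (i, j))) (fun i j => (sE _).1))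
  (side2 (fun i j => e (phi (i, j))) (fun i j => (eE _).1)) Cs_small (leqnn _) K_large L_disj).
- by move=> i j v vP; rewrite LE; apply/or3P; apply: Or31; apply/existsP; exists j.
- by move=> i j j' v vP vP'; have /phi_inj [] := ming.1.2 _ _ _ vP vP'.
- by move=> v vF vC; rewrite in_setD vC vF.
- exact: P_path.
- exact: special.
Qed.

End Choice.

(** With short paths only, the forced set has O(kt) vertices. It is put into [Cs], so [Mid] is
    empty, and every vertex keeps most of its neighbours unforced. *)
Lemma short_case : T * k <= #|[set i | size (g i) <= 4]| ->
  exists Q : {set {set V}},
    [/\ partition Q [set: V], #|Q| = t & forall Vi, Vi \in Q -> strongly_kconnected_on E k Vi].
Proof.
move=> many; have [phi phi_inj phi_short] : exists2 phi : 'I_T * 'I_k -> 'I_(170 * (k * t)),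
    injective phi & forall p, phi p \in [set i | size (g i) <= 4].
  by apply: embed_into; rewrite card_prod !card_ord.
have short p : size (g (phi p)) <= 4 by have := phi_short p; rewrite inE.
have short' p : size (rev (g (phi p))) <= 4 by rewrite size_rev.
pose Cs := X :|: Y :|: forced (layer phi).
have XC : X \subset Cs by rewrite /Cs -setUA subsetUl.
have YC : Y \subset Cs by rewrite /Cs setUAC subsetUr.
have FC : forced (layer phi) \subset Cs by apply: subsetUr.
have S1 := setting1 phi XC YC; have S2 := setting2 phi XC YC.
apply: (build (Cs := Cs) phi_inj).
- have := forced_short S1 short.
  have := (leq_card_setU (X :|: Y) (forced (layer phi))).1; have := (leq_card_setU X Y).1.
  by rewrite cX cY -/Cs; move: #|Cs| #|X :|: Y| #|forced _| => a b c; lia.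
- by move=> st stX; apply: (side_short S1).
- by move=> st stY; apply: (side_short S2).
- by move=> v _ _; apply: Or31; split; [apply: (short_cared S1) | apply: (short_cared S2)].
Qed.

Section Long.
Let Sh := [set i | size (g i) <= 4].
Let Dv := [set v | [exists i, (i \in Sh) && (v \in g i)]].
Hypothesis few_short : #|Sh| < T * k.

Lemma card_Dv : #|Dv| <= 8 * (k * t).
Proof.
have sub : Dv \subset \bigcup_(i in Sh) [set v in g i].
  apply/subsetP => v; rewrite inE => /existsP [i /andP [iS vi]].
  by apply/bigcupP; exists i => //; rewrite inE.
apply: leq_trans (subset_leq_card sub) _; apply: leq_trans (card_bigcup_le _ _) _.
apply: (@leq_trans (\sum_(i in Sh) 4)).
  apply: leq_sum => i; rewrite inE => iS; rewrite cardsE; exact: leq_trans (card_size _) iS.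
rewrite sum_nat_const; move: few_short; rewrite /T; move: #|Sh| => x; lia.
Qed.

(** One constraint per vertex of [Dv] and direction makes at most 16kt rows, so rounding keeps at
    least (85 - 16)kt paths. Removing fewer than 2kt short ones leaves over 64kt, which is 32 times
    the number of paths needed, the loss in [sparse_subset]. *)
Lemma rounded_choice : exists F1 : {set 'I_(170 * (k * t))},
  [/\ 64 * (k * t) <= #|F1|, forall i, i \in F1 -> 4 < size (g i) &
    forall v, v \in Dv -> 2 * (\sum_(i in F1) #|out E v :&: [set w in g i]|) <= #|out E v| /\
      2 * (\sum_(i in F1) #|out (rv E) v :&: [set w in g i]|) <= #|out (rv E) v|].
Proof.
pose a (r : {v | v \in Dv} * bool) i :=
  #|(if r.2 then out E (val r.1) else out (rv E) (val r.1)) :&: [set w in g i]|.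
have [F0 [aF0 cF0]] := half_rounding a.
exists (F0 :\: Sh); split.
- move: cF0; rewrite card_ord card_prod card_bool card_sig.
  have -> : #|[pred v | v \in Dv]| = #|Dv| by apply: eq_card.
  have := card_Dv; have := cardsID Sh F0; have := subset_leq_card (subsetIr F0 Sh); move: few_short; rewrite /T.
  move: #|Sh| #|Dv| #|F0| #|F0 :&: Sh| #|F0 :\: Sh| => x1 x2 x3 x4 x5; lia.
- by move=> i; rewrite !inE -ltnNge => /andP [].
- move=> v vD; have le (N : {set V}) :
      \sum_(i in F0 :\: Sh) #|N :&: [set w in g i]| <= \sum_(i in F0) #|N :&: [set w in g i]|.
    rewrite [X in _ <= X](bigID (fun i => i \notin Sh)) /=; apply: leq_trans (leq_addr _ _).
    by rewrite leq_eqVlt; apply/orP; left; apply/eqP; apply: eq_bigl => i; rewrite inE andbC.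
  have disj i j w : w \in g i -> w \in g j -> i = j by apply: ming.1.2.
  split.
    have := aF0 (exist _ v vD, true); rewrite /a /= => h; apply: leq_trans (disjoint_sum _ disj).
    by apply: leq_trans h; rewrite leq_mul.
  have := aF0 (exist _ v vD, false); rewrite /a /= => h; apply: leq_trans (disjoint_sum _ disj).
  by apply: leq_trans h; rewrite leq_mul.
Qed.

(** The weight of [j] at [i] counts the neighbours on path [j] of the first two and last two
    vertices of path [i]. Truncating neighbourhoods to [K] gives all four the same scale: rows sum
    to at most 4K, and [sparse_subset] leaves K/2. *)
Lemma path_choice : exists2 phi : 'I_T * 'I_k -> 'I_(170 * (k * t)), injective phi &
  [/\ forall p, 4 < size (g (phi p)),
    forall v, v \in Dv -> 2 * (\sum_p #|out E v :&: [set w in g (phi p)]|) <= #|out E v| /\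
      2 * (\sum_p #|out (rv E) v :&: [set w in g (phi p)]|) <= #|out (rv E) v|,
    forall p v, v \in take 2 (g (phi p)) ->
      2 * (\sum_(p' | p' != p) #|trunc K (out E v) :&: [set w in g (phi p')]|) <= K &
    forall p v, v \in take 2 (rev (g (phi p))) ->
      2 * (\sum_(p' | p' != p) #|trunc K (out (rv E) v) :&: [set w in g (phi p')]|) <= K].
Proof.
have [F1 [cF1 longF1 DvF1]] := rounded_choice.
pose I := {i | i \in F1}.
pose w (i j : I) := \sum_(v <- take 2 (g (val i))) #|trunc K (out E v) :&: [set x in g (val j)]| +
  \sum_(v <- take 2 (rev (g (val i)))) #|trunc K (out (rv E) v) :&: [set x in g (val j)]|.
have cI : #|{: I}| = #|F1| by rewrite card_sig; apply: eq_card.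
have disj (i j : I) x : x \in g (val i) -> x \in g (val j) -> i = j.
  by move=> xi xj; apply: val_inj; apply: ming.1.2 xi xj.
have sz (s : seq V) : size (take 2 s) <= 2 by rewrite size_take; case: ltnP.
have row (R : rel V) (s : seq V) : (forall v, K <= #|out R v|) ->
    \sum_(j : I) \sum_(v <- take 2 s) #|trunc K (out R v) :&: [set x in g (val j)]| <= 2 * K.
  move=> degR; rewrite exchange_big /=.
  apply: leq_trans (leq_sum_const (m := K) _) _; last by rewrite leq_mul.
  by move=> v _; apply: leq_trans (disjoint_sum _ disj) _; rewrite card_trunc.
have [F [cF wF]] : exists F : {set I}, #|{: I}| <= 32 * #|F| /\
    forall i, i \in F -> 8 * \sum_(j in F | j != i) w i j <= 4 * K.
  apply: sparse_subset => i; apply: (@leq_trans (\sum_j w i j)).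
    by rewrite [X in _ <= X](bigID (fun j => j != i)) /= leq_addr.
  rewrite big_split /= -[4]/(2 + 2) mulnDl leq_add //; exact: row.
have [h hinj hF] : exists2 h : 'I_T * 'I_k -> I, injective h & forall p, h p \in F.
  apply: embed_into; rewrite card_prod !card_ord; move: cF; rewrite cI /T.
  by move: #|F| #|F1| cF1 => x y; lia.
exists (fun p => val (h p)); first by move=> p q /val_inj /hinj.
split.
- by move=> p; apply: longF1; apply: valP.
- move=> v /DvF1 [d1 d2]; split; [apply: leq_trans d1 | apply: leq_trans d2]; rewrite leq_mul //.
    apply: (leq_sum_inj (h := fun p => val (h p)) (fun i => #|out E v :&: [set w in g i]|)).
      by move=> p q /val_inj /hinj.
    by move=> p _; apply: valP.
  apply: (leq_sum_inj (h := fun p => val (h p)) (fun i => #|out (rv E) v :&: [set w in g i]|)).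
    by move=> p q /val_inj /hinj.
  by move=> p _; apply: valP.
- move=> p v v2; have := wF _ (hF p).
  have : \sum_(p' | p' != p) #|trunc K (out E v) :&: [set x in g (val (h p'))]| <=
      \sum_(j in F | j != h p) w (h p) j.
    apply: leq_trans (leq_sum_inj (B := fun j => (j \in F) && (j != h p))
      (fun j => #|trunc K (out E v) :&: [set x in g (val j)]|) hinj _) _.
      by move=> q qp; rewrite hF (inj_eq hinj).
    apply: leq_sum => j _; apply: leq_trans (leq_addr _ _).
    exact: (leq_sum_mem (fun v => #|trunc K (out E v) :&: [set x in g (val j)]|) v2).
  by move: (\sum_(_ | _) _) (\sum_(_ | _) _) => x y; lia.
- move=> p v v2; have := wF _ (hF p).
  have : \sum_(p' | p' != p) #|trunc K (out (rv E) v) :&: [set x in g (val (h p'))]| <=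
      \sum_(j in F | j != h p) w (h p) j.
    apply: leq_trans (leq_sum_inj (B := fun j => (j \in F) && (j != h p))
      (fun j => #|trunc K (out (rv E) v) :&: [set x in g (val j)]|) hinj _) _.
      by move=> q qp; rewrite hF (inj_eq hinj).
    apply: leq_sum => j _; apply: leq_trans (leq_addl _ _).
    exact: (leq_sum_mem (fun v => #|trunc K (out (rv E) v) :&: [set x in g (val j)]|) v2).
  by move: (\sum_(_ | _) _) (\sum_(_ | _) _) => x y; lia.
Qed.

(** Five vertices are the least number for which the first two, the last two and a middle vertex are
    distinct; this fixes the threshold for short paths. *)
Lemma take2_rev (s : seq V) v : uniq s -> 4 < size s -> v \in take 2 s -> v \notin take 2 (rev s).
Proof.
move=> us sz v2; have vs := mem_take v2; move: v2; rewrite in_take // => v2.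
have iv := vs; rewrite -index_mem in iv.
have e : v = nth v (rev s) (size s - (index v s).+1).
  rewrite nth_rev; last by move: sz; move: (size s) => n; lia.
  by rewrite subnSK // subKn ?nth_index // ltnW.
have sz' : size s - (index v s).+1 < size s by move: sz; move: (size s) => n; lia.
rewrite in_take ?mem_rev // {1}e index_uniq ?rev_uniq ?size_rev //.
by move: sz v2; move: (size s) (index v s) => n m; lia.
Qed.

Lemma set_rev (s : seq V) : [set w in rev s] = [set w in s].
Proof. by apply/setP => w; rewrite !inE mem_rev. Qed.

Lemma long_case : exists Q : {set {set V}},
    [/\ partition Q [set: V], #|Q| = t & forall Vi, Vi \in Q -> strongly_kconnected_on E k Vi].
Proof.
have [phi phi_inj [long selD sel1 sel2]] := path_choice.
pose En (h : 'I_(170 * (k * t)) -> seq V) := \bigcup_i [set v in take 2 (h i)].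
pose Cs := X :|: Y :|: Dv :|: En g :|: En g'.
have XC : X \subset Cs by rewrite /Cs -!setUA subsetUl.
have YC : Y \subset Cs by rewrite /Cs -setUA -setUA [X :|: Y]setUC -setUA subsetUl.
have C1 i v : v \in take 2 (g i) -> v \in Cs.
  by move=> v2; rewrite !in_setU; apply/orP; left; apply/orP; right; apply/bigcupP; exists i; rewrite ?inE.
have C2 i v : v \in take 2 (rev (g i)) -> v \in Cs.
  by move=> v2; rewrite !in_setU; apply/orP; right; apply/bigcupP; exists i; rewrite ?inE.
have Cmid p v : v \in g (phi p) -> v \notin take 2 (g (phi p)) -> v \notin take 2 (rev (g (phi p))) -> v \notin Cs.
  move=> vp v1 v2; rewrite !in_setU; apply/negP => /orP [/orP [/orP [/orP [vX|vY]|vD]|]|].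
  - by move: v1; have [q ->] := only_head ming vX vp; rewrite /= mem_head.
  - have vp' : v \in rev (g (phi p)) by rewrite mem_rev.
    by move: v2; have [q ->] := only_head ming' vY vp'; rewrite /= mem_head.
  - move: vD; rewrite inE => /existsP [i /andP [iS vi]].
    have e := ming.1.2 _ _ _ vp vi; move: iS; rewrite -e inE; have := long p; lia.
  - case/bigcupP => i _; rewrite inE => v3; have e := ming.1.2 _ _ _ vp (mem_take v3).
    by move: v1; rewrite e v3.
  - case/bigcupP => i _; rewrite inE => v3; have := mem_take v3; rewrite mem_rev => v4.
    by have e := ming.1.2 _ _ _ vp v4; move: v2; rewrite e v3.
have Cmid' p v : v \in rev (g (phi p)) -> v \notin take 2 (rev (g (phi p))) ->
    v \notin take 2 (rev (rev (g (phi p)))) -> v \notin Cs.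
  by rewrite mem_rev revK => vp v1 v2; apply: Cmid vp v2 v1.
have long' p : 4 < size (rev (g (phi p))) by rewrite size_rev.
have S1 := setting1 phi XC YC; have S2 := setting2 phi XC YC.
have cEn h : (forall i, size (take 2 (h i)) <= 2) -> #|En h| <= 340 * (k * t).
  move=> h2; apply: leq_trans (card_bigcup_le _ _) _; apply: (@leq_trans (\sum_(i < 170 * (k * t)) 2)).
    by apply: leq_sum => i _; rewrite cardsE; apply: leq_trans (card_size _) (h2 i).
  by rewrite sum_nat_const card_ord; lia.
have sz (s : seq V) : size (take 2 s) <= 2 by rewrite size_take; case: ltnP.
apply: (build (Cs := Cs) phi_inj).
(* In units of kt: 424 for [X] and [Y], 8 for [Dv] and 340 for each family of ends, in all 1112. *)
- have l1 := (leq_card_setU (X :|: Y :|: Dv :|: En g) (En g')).1.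
  have l2 := (leq_card_setU (X :|: Y :|: Dv) (En g)).1.
  have l3 := (leq_card_setU (X :|: Y) Dv).1; have l4 := (leq_card_setU X Y).1.
  have l5 := cEn g (fun i => sz _); have l6 := cEn g' (fun i => sz _); have l7 := card_Dv.
  rewrite cX cY in l4; rewrite -/Cs in l1; move: l1 l2 l3 l4 l5 l6 l7.
  move: #|Cs| #|En g| #|En g'| #|Dv| #|X :|: Y| => c e e' d xy.
  move: #|X :|: Y :|: Dv| #|_ :|: En g| => a b; lia.
- move=> st stX; apply: (side_long S1 stX long C1 Cmid sel1).
- move=> st stY; apply: (side_long S2 stY long' C2 Cmid') => p v v2.
  rewrite (eq_bigr (fun p' => #|trunc K (out (rv E) v) :&: [set w in g (phi p')]|)).
    exact: sel2 v2.
  by move=> p' _; rewrite set_rev.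
- move=> v vC vF; case: (classic (exists i, v \in g i)) => [[i vi]|nv]; last first.
    have {}nv j : v \notin g j by apply/negP => vj; apply: nv; exists j.
    have nv' j : v \notin rev (g j) by rewrite mem_rev.
    apply: Or31; move: vC; rewrite !in_setU => /orP [/orP [/orP [/orP [vX|vY]|vD]|]|].
    + by split; [apply: (unused_cared S1) | apply: (unused_rich S2)].
    + by split; [apply: (unused_rich S1) | apply: (unused_cared S2)].
    + by move: vD; rewrite inE => /existsP [i /andP [_ vi]]; move: (nv i); rewrite vi.
    + by case/bigcupP => i _; rewrite inE => /mem_take vi; move: (nv i); rewrite vi.
    + by case/bigcupP => i _; rewrite inE => /mem_take vi; move: (nv' i); rewrite vi.
  have vi' : v \in rev (g i) by rewrite mem_rev.
  case: (leqP (size (g i)) 4) => [short|long_i].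
    have vD : v \in Dv by rewrite inE; apply/existsP; exists i; rewrite inE short.
    have [d1 d2] := selD v vD; apply: Or31; split; first exact: (rounded_cared S1 d1).
    apply: (rounded_cared S2); rewrite (eq_bigr (fun p => #|out (rv E) v :&: [set w in g (phi p)]|)) //.
    by move=> p _; rewrite set_rev.
  case: (boolP (v \in take 2 (g i))) => v1.
    have all2 : to_all (rv E) W v.
      by apply: (late_to_all S2 vi'); apply: take2_rev v1 => //; apply: minimal_uniq ming i.
    case: (start_trapped S1 v Cmid) => [c|le]; last exact: Or32.
    by apply: Or31; split=> //; apply: Or32.
  have all1 := late_to_all S1 vi v1.
  case: (boolP (v \in take 2 (rev (g i)))) => v2; last first.
    by apply: Or31; split; apply: Or32 => //; apply: (late_to_all S2 vi' v2).
  case: (start_trapped S2 v Cmid') => [c|le]; last exact: Or33.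
  by apply: Or31; split=> //; apply: Or32.
Qed.

End Long.

Lemma build_partition : exists Q : {set {set V}},
    [/\ partition Q [set: V], #|Q| = t & forall Vi, Vi \in Q -> strongly_kconnected_on E k Vi].
Proof.
by case: (leqP (T * k) #|[set i | size (g i) <= 4]|) => [/short_case | /long_case].
Qed.

End Build.

Theorem theorem1 :
  exists c : nat, 0 < c /\
    forall (k t : nat), 0 < k -> 0 < t ->
    forall (V : finType) (E : rel V),
      is_tournament E ->
      strongly_kconnected_on E (c * k * t) [set: V] ->
      exists P : {set {set V}},
        [/\ partition P [set: V], #|P| = t &
            forall Vi, Vi \in P -> strongly_kconnected_on E k Vi].
Proof.
(* 212 = 170 + 2 * 21: the linkage has 170kt paths, and each of the 2t colours gets 21k hubs in X and in Y. *)
exists (100 * 1000); split=> // k t k0 t0 V E tour.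
set K := 100 * 1000 * k * t => con; have KE : K = 100 * 1000 * (k * t) by rewrite /K -mulnA.
have kt0 : 0 < k * t by rewrite muln_gt0 k0.
have con' := kconn_rv con; have tour' := tour_rv tour.
have deg := kconn_out tour con; have deg' := kconn_out tour' con'.
have KV : K < #|[set: V]| := con.1.
have hV : 212 * (k * t) <= #|[set: V]| by move: #|[set: V]| KV => n; lia.
have [X [D [_ cX lowX highX]]] := lowest (fun v => #|out E v|) hV.
have hV' : 212 * (k * t) <= #|~: X|.
  by have := cardsC X; rewrite cX -cardsT; move: #|[set: V]| #|~: X| KV => n m; lia.
have [Y [D' [YX cY lowY highY]]] := lowest (fun v => #|out (rv E) v|) hV'.
have XY v : v \in X -> v \in Y -> False.
  by move=> vX /(subsetP YX); rewrite inE vX.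
have MX : 170 * (k * t) <= #|X| by rewrite cX leq_mul.
have MY : 170 * (k * t) <= #|Y| by rewrite cY leq_mul.
have [g0 Lg0] : exists g : 'I_(170 * (k * t)) -> seq V, linkage E X Y g.
  by apply: menger_tournament con _ MX MY; rewrite KE leq_mul.
have [g ming] := minimal_exists Lg0.
have ming' := minimal_rev ming.
have [U [UX cU U_disj]] : exists U : 'I_(2 * t) -> {set V}, [/\ forall i, U i \subset unused X g,
    forall i, #|U i| = 21 * k & forall i i' v, v \in U i -> v \in U i' -> i = i'].
  by apply: split_hubs; have := card_unused ming; rewrite cX; move: #|unused _ _| => n; lia.
have [W [WY cW W_disj]] : exists U : 'I_(2 * t) -> {set V}, [/\ forall i, U i \subset unused Y (fun i => rev (g i)),
    forall i, #|U i| = 21 * k & forall i i' v, v \in U i -> v \in U i' -> i = i'].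
  by apply: split_hubs; have := card_unused ming'; rewrite cY; move: #|unused _ _| => n; lia.
apply: (@build_partition V E t k K D D' X Y g U W k0 t0) => //.
- by rewrite KE.
- by move=> v vX _; apply: highX; rewrite ?inE.
- by move=> v vY vX; apply: highY; rewrite ?inE.
- by move=> i u /(subsetP (UX i)) /unusedP.
- by move=> i u /(subsetP (WY i)) /unusedP [uY un]; split=> // j; rewrite -mem_rev.
Qed.
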